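(* Let $d\ge2$ and $\phi\in C_c^\infty(\mathbb{C})$. There is a constant $C_{d,\phi}$, depending only on $d$ and $\phi$, such that for every $f\in\mathbb{C}[X]$ of degree $d$, writing $f'(z)=a\prod_{j=1}^L(z-w_j)^{m_j}$ with $w_1,\dots,w_L$ the distinct roots of $f'$ and $m_j\ge 1$ their multiplicities, $$|I_\phi(f)|\ \le\ C_{d,\phi}\ \max_{1\le j\le L}\ \min_{\mathcal{C}\ni w_j}\ \left[\frac{1}{\bigl|a\prod_{w_k\notin\mathcal{C}}(w_j-w_k)^{m_k}\bigr|}\right]^{2/(S(\mathcal{C})+1)},$$ where the minimum is over all subsets (root clusters) $\mathcal{C}\subseteq\{w_1,\ldots,w_L\}$ containing $w_j$, and $S(\mathcal{C})=\sum_{w_k\in\mathcal{C}}m_k$.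
   Context: For $z=x+iy\in\mathbb{C}$ (with $x,y$ real) put $\mathrm{e}(z)=e^{2\pi i x}e^{2\pi i y}$, and for $\phi\in C_c^\infty(\mathbb{C})$ (smooth in the real sense on $\mathbb{C}\simeq\mathbb{R}^2$) let $I_\phi(f)=\int_{\mathbb{C}}\mathrm{e}(f(z))\,\phi(z)\,dz$, where $dz$ is Lebesgue measure on $\mathbb{C}\simeq\mathbb{R}^2$. An empty product equals $1$. *)

(* Defs.v *)
From HB Require Import structures.
From mathcomp Require Import all_boot all_order all_algebra.
From mathcomp Require Import complex.
From mathcomp Require Import all_classical all_reals all_analysis.

Set Implicit Arguments.
Unset Strict Implicit.
Unset Printing Implicit Defensive.

Import Order.TTheory GRing.Theory Num.Theory.
Import numFieldNormedType.Exports.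

Local Open Scope classical_set_scope.
Local Open Scope complex_scope.
Local Open Scope ring_scope.

Definition complex_of_pair (R : realType) (p : R * R) : R[i] := p.1 +i* p.2.

(* The library norm `|z| on R[i] takes values in R[i]; normc z is the same
   number as an element of R. *)
Definition cabs (R : realType) (z : R[i]) : R := ComplexField.Normc.normc z.

Definition unit_dir (R : realType) (b : bool) : R * R :=
  if b then (0, 1) else (1, 0).

Definition partial (R : realType) (b : bool) (g : R * R -> R) : R * R -> R :=
  fun p => 'D_(unit_dir R b) g p.

Definition iter_partial (R : realType) (s : seq bool) (g : R * R -> R) :
  R * R -> R := foldr (@partial R) g s.

(* Partial derivatives of all orders, in every order of differentiation, exist
   and are continuous. *)
Definition smooth2 (R : realType) (g : R * R -> R) : Prop :=
  forall s : seq bool,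
    continuous (iter_partial s g) /\
    forall (b : bool) (p : R * R), derivable (iter_partial s g) p (unit_dir R b).

Definition Cc_infty (R : realType) (phi : R[i] -> R[i]) : Prop :=
  [/\ smooth2 (fun p => complex.Re (phi (complex_of_pair p))),
      smooth2 (fun p => complex.Im (phi (complex_of_pair p))) &
      compact (closure [set p : R * R | phi (complex_of_pair p) != 0])].

Definition cis (R : realType) (t : R) : R[i] := cos t +i* sin t.

(* e(x + iy) = e^{2 pi i x} e^{2 pi i y}: both exponents are real multiples of
   i, so this is a unimodular additive character, not exp(2 pi i z). *)
Definition echar (R : realType) (z : R[i]) : R[i] :=
  cis (2 * pi * complex.Re z) * cis (2 * pi * complex.Im z).

Definition complex_integral (R : realType) (h : R[i] -> R[i]) : R[i] :=
  let mu := (@lebesgue_measure R \x @lebesgue_measure R)%E in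
  Rintegral mu setT (fun p => complex.Re (h (complex_of_pair p))) +i*
  Rintegral mu setT (fun p => complex.Im (h (complex_of_pair p))).

Definition osc_integral (R : realType) (phi : R[i] -> R[i])
    (f : {poly R[i]}) : R[i] :=
  complex_integral (fun z => echar f.[z] * phi z).

(* The roots are indexed by 'I_L through an injective w, so that a set of
   indices C stands for the root cluster {w k | k in C}. *)
Section RootClusters.
Variables (R : realType) (L : nat) (a : R[i]).
Variables (w : 'I_L -> R[i]) (m : 'I_L -> nat).

Definition cluster_mult (C : {set 'I_L}) : nat := (\sum_(k in C) m k)%N.

Definition cluster_term (j : 'I_L) (C : {set 'I_L}) : R :=
  (1 / cabs (a * \prod_(k < L | k \notin C) (w j - w k) ^+ m k))
    `^ (2 / ((cluster_mult C)%:R + 1)).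

(* The default value of the minimum is its value at the cluster of all roots,
   which is in the range of the minimum. *)
Definition min_cluster_term (j : 'I_L) : R :=
  \big[Num.min/cluster_term j finset.setT]_(C : {set 'I_L} | j \in C)
    cluster_term j C.

(* All the terms are nonnegative, so that the default value 0 is harmless. *)
Definition max_min_cluster_term : R :=
  \big[Num.max/0]_(j < L) min_cluster_term j.

End RootClusters.

(* Main.v *)
Require Import Defs.
From HB Require Import structures.
From mathcomp Require Import all_boot all_order all_algebra.
From mathcomp Require Import complex.
From mathcomp Require Import all_classical all_reals all_analysis.
From mathcomp Require Import measurable_realfun ring lra.

Set Implicit Arguments.
Unset Strict Implicit.
Unset Printing Implicit Defensive.

Import Order.TTheory GRing.Theory Num.Theory.
Import numFieldNormedType.Exports.
Local Open Scope ring_scope.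

(** All that is used of f is a lower bound for |f'|. Put r^2 = max_j min_C of the cluster
terms. If w_j is the root nearest to z, then |w_j - w_k| <= 2 |z - w_k| for
every k, so that for every cluster C containing w_j the factors outside C are
bounded below by |w_j - w_k| / 2 and those inside C by |z - w_j|. With the
minimizing C this says that |f'(z)| >= c |z - w_j| / r^2 as soon as
|z - w_j| >= r ([cluster_lower_bound]).

The phase 2 pi (Re f + Im f) is harmonic with squared gradient
8 pi^2 |f'|^2, so that its cosine and its sine are functions E with
Laplacian - 8 pi^2 |f'|^2 E ([is_wave]). If G is smooth with compact support,
Green's identity (for each coordinate, the fundamental theorem of calculus on
lines and Fubini: [green]) gives
  \int E Q G = - (8 pi^2)^-1 \int E (Laplacian of G), where Q = |f'|^2.
One integration by parts would leave the logarithmically divergent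
\int r^2 / |z - w|^2; the Laplacian accounts for two, hence for the integrable
r^4 / |z - w|^4.

Dividing phi by Q is not possible near the roots. Instead of cutting them out,
smear Q: let A be the product |a|^2 \prod_k (|z - w_k|^2 + r^2)^(m_k), which
is at least Q, and take G = phi (2 A - Q) / A^2. It is smooth, and
  phi - Q G = phi (1 - Q / A)^2,
where the square makes the right-hand side O(r^4 / |z - w_j|^4) far from the
roots. Since A is a product of quadratic factors, each derivative of A or of Q
(relative to the size A) and of 1 / A (relative to the size 1 / A) costs a
factor O((|z - w_j|^2 + r^2)^(-1/2)); this is the calculus of [dominated]. With the lower bound for A this yields
\int E phi = \int H, where
  |H| <= C r^4 (1 + \sum_k (|z - w_k|^2 + r^2)^-2)
on the support of phi. The integral of each summand is at most (pi / r)^2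
([integral_plane_kernel]), so that the total is O(r^2) when r <= 1; when
r >= 1 the trivial bound is enough ([oscillatory_estimate]). *)

(** * Continuity, measurability and integration on the plane *)

Section Continuity.
Variable R : realType.

Lemma continuousD_fun (T : topologicalType) (f g : T -> R) :
  continuous f -> continuous g -> continuous (fun x => f x + g x).
Proof. by move=> cf cg x; apply: cvgD; [exact: cf|exact: cg]. Qed.

Lemma continuousM_fun (T : topologicalType) (f g : T -> R) :
  continuous f -> continuous g -> continuous (fun x => f x * g x).
Proof. by move=> cf cg x; apply: cvgM; [exact: cf|exact: cg]. Qed.

Lemma continuousV_fun (T : topologicalType) (f : T -> R) :
  (forall x, f x != 0) -> continuous f -> continuous (fun x => (f x)^-1).
Proof. by move=> f0 cf x; apply: cvgV; [exact: f0|exact: cf]. Qed.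

Lemma continuous_exprn (T : topologicalType) (f : T -> R) n :
  continuous f -> continuous (fun x => f x ^+ n).
Proof.
move=> cf x; apply: (cvg_comp f (fun t => t ^+ n) (cf x)).
exact: exprn_continuous.
Qed.

End Continuity.

Section Plane.
Variable R : realType.
Local Open Scope classical_set_scope.
Local Notation leb := (@lebesgue_measure R).
Local Notation mu := (@lebesgue_measure R \x @lebesgue_measure R)%E.

(** The product sigma-algebra contains the open sets because the rectangles
with rational endpoints form a countable basis. *)
Lemma open_measurable_plane (U : set (R * R)) : open U -> measurable U.
Proof.
move=> oU.
pose I := ((rat * rat) * (rat * rat))%type.
pose rect (i : I) : set (R * R) :=
  `]ratr i.1.1, ratr i.1.2[ `*` `]ratr i.2.1, ratr i.2.2[.
pose F (i : I) := if `[< rect i `<=` U >] then rect i else set0.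
have -> : U = \bigcup_i F i.
  apply/seteqP; split => [p Up|p [i _]]; last first.
    by rewrite /F; case: asboolP => // iU /iU.
  have /nbhs_ballP [e /= e0 eU] := open_nbhs_nbhs (conj oU Up).
  have lo (x : R) : x - e < x by rewrite ltrBlDr ltrDl.
  have hi (x : R) : x < x + e by rewrite ltrDl.
  have [a1 Ha1] := rat_in_itvoo (lo p.1).
  have [b1 Hb1] := rat_in_itvoo (hi p.1).
  have [a2 Ha2] := rat_in_itvoo (lo p.2).
  have [b2 Hb2] := rat_in_itvoo (hi p.2).
  move: Ha1 Hb1 Ha2 Hb2; rewrite !in_itv/=.
  move=> /andP[a1l a1r] /andP[b1l b1r] /andP[a2l a2r] /andP[b2l b2r].
  exists ((a1, b1), (a2, b2)) => //; rewrite /F; case: asboolP => [_|[]].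
    by split => /=; rewrite in_itv/=; apply/andP.
  move=> q [] /=; rewrite !in_itv/= => /andP[q1l q1r] /andP[q2l q2r].
  apply: eU; split; rewrite /ball /= ltr_norml; apply/andP; split; lra.
apply: countable_bigcupT_measurable => [|i]; first exact: countableP.
rewrite /F; case: ifP => _; last exact: measurable0.
by apply: measurableX; exact: measurable_itv.
Qed.

Lemma continuous_measurable_plane (h : R * R -> R) :
  continuous h -> measurable_fun setT h.
Proof.
move=> /continuousP ch; apply: (measurability _ (RGenOpens.measurableE R)).
move=> _ [_ [a [b ->] <-]]; rewrite setTI; apply: open_measurable_plane.
exact/ch/interval_open.
Qed.

(** Compactly supported functions are handled as functions that vanish off some
[box M]. *)
Definition box (M : R) : set (R * R) := `[- M, M] `*` `[- M, M].

Lemma measurable_box M : measurable (box M).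
Proof. by apply: measurableX; exact: measurable_itv. Qed.

Lemma box_lty M : (mu (box M) < +oo)%E.
Proof.
have itv_lty : (leb [set` `[- M, M]%R] < +oo)%E.
  by rewrite lebesgue_measure_itv/=; case: ifP => // _; rewrite -EFinD ltry.
by rewrite product_measure1E ?lte_mul_pinfty//; rewrite ge0_fin_numE.
Qed.

Lemma compact_box (M : R) : compact (box M).
Proof. by apply: compact_setX; exact: segment_compact. Qed.

Lemma supported_bounded (M : R) (u : R * R -> R) : continuous u ->
  (forall p, ~ box M p -> u p = 0) -> exists2 B, 0 <= B & forall p, `|u p| <= B.
Proof.
move=> cu u0.
have : compact (u @` box M).
  by apply: continuous_compact (@compact_box M); exact: continuous_subspaceT.
move=> /compact_bounded [N [Nr HN]]; exists (`|N| + 1); first by rewrite addr_ge0.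
move=> p; have [Mp|Mp] := pselect (box M p); last by rewrite u0// normr0 addr_ge0.
by apply: (HN (`|N| + 1)); [rewrite (le_lt_trans (ler_norm N))// ltrDl|exists p].
Qed.

Lemma supported_integrable M (h : R * R -> R) : continuous h ->
  (forall p, ~ box M p -> h p = 0) -> mu.-integrable setT (EFin \o h).
Proof.
move=> ch h0.
have hB : mu.-integrable (box M) (EFin \o h).
  apply: measurable_bounded_integrable.
  - exact: measurable_box.
  - exact: box_lty.
  - by apply: measurable_funTS; exact: continuous_measurable_plane.
  have [B _ hB] := supported_bounded ch h0.
  by exists B; split=> [|n Bn p _ /=]; rewrite ?num_real// (le_trans (hB p)) ?ltW.
have hB' := (@integrable_mkcond _ _ _ mu _ (EFin \o h) (measurable_box M)).1 hB.
apply: (@eq_integrable _ _ _ mu setT measurableT _ _ _ hB') => p _.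
rewrite /patch; case: ifPn => // /negP pM.
by rewrite /= h0 // => /mem_set.
Qed.

Lemma integral_setT_support (M : R) (g : R -> R) :
  (forall x, M < `|x| -> g x = 0) ->
  (\int[leb]_x (g x)%:E = \int[leb]_(x in [set` `[- M, M]%R]) (g x)%:E)%E.
Proof.
move=> g0; rewrite [RHS]integral_mkcond; apply: eq_integral => x _.
rewrite /patch; case: ifPn => //; rewrite notin_setE /= in_itv /= => /negP.
by rewrite -ler_norml -ltNge => /g0 ->.
Qed.

(** The fundamental theorem of calculus on an interval that is strictly larger
than [-M, M], so that g vanishes at both ends. *)
Lemma integral_derivative_eq0 (M : R) (g g1 : R -> R) :
  (forall x, is_derive x (1 : R) g (g1 x)) -> continuous g1 ->
  (forall x, M < `|x| -> g x = 0) -> (forall x, M < `|x| -> g1 x = 0) ->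
  (\int[leb]_x (g1 x)%:E = 0)%E.
Proof.
move=> dg cg1 g0 g10.
have cg : continuous g.
  by move=> x; apply/differentiable_continuous/derivable1_diffP; case: (dg x).
pose N := `|M| + 1.
have MN : M < N by rewrite (le_lt_trans (ler_norm M))// ltrDl.
have N0 : 0 < N by rewrite ltr_wpDl.
rewrite (@integral_setT_support N); last by move=> x Nx; apply/g10/(lt_trans MN).
rewrite (continuous_FTC2 (F := g)).
- by rewrite !g0 ?subee// ?normrN gtr0_norm.
- by rewrite gtrN.
- exact: continuous_subspaceT.
- split; first by move=> x _; case: (dg x).
  + exact/cvg_at_right_filter/cg.
  + exact/cvg_at_left_filter/cg.
- by move=> x _; rewrite derive1E; case: (dg x).
Qed.

(** Reduces directional derivatives along the axes to derivatives of functions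
of one variable, to which the fundamental theorem of calculus applies. *)
Lemma is_derive_slice (u : R * R -> R) (b : bool) (x y d : R) :
  is_derive (x, y) (unit_dir R b) u d ->
  if b then is_derive y (1 : R) (fun t => u (x, t)) d
  else is_derive x (1 : R) (fun t => u (t, y)) d.
Proof.
have E (z w : R) : z *: (0 : R) + w = w by rewrite scaler0 add0r.
case: b; rewrite /unit_dir => -[du <-].
- have Eq : (fun h : R => h^-1 *: ((u \o shift (x, y)) (h *: (0, 1)) - u (x, y)))
    = (fun h : R => h^-1 *:
        (((fun t => u (x, t)) \o shift y) (h *: (1 : R)) - u (x, y))).
    by apply/funext => h /=; congr (_ *: (u _ - _)); congr pair; exact: E.
  by split; [move: du; rewrite /derivable|rewrite /derive]; rewrite Eq.
- have Eq : (fun h : R => h^-1 *: ((u \o shift (x, y)) (h *: (1, 0)) - u (x, y)))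
    = (fun h : R => h^-1 *:
        (((fun t => u (t, y)) \o shift x) (h *: (1 : R)) - u (x, y))).
    by apply/funext => h /=; congr (_ *: (u _ - _)); congr pair; exact: E.
  by split; [move: du; rewrite /derivable|rewrite /derive]; rewrite Eq.
Qed.

(** Fubini lets the integration in the direction of differentiation come
first. *)
Lemma integral_partial_eq0 (b : bool) (M : R) (u u1 : R * R -> R) :
  (forall p, is_derive p (unit_dir R b) u (u1 p)) -> continuous u1 ->
  (forall p, ~ box M p -> u p = 0) -> (forall p, ~ box M p -> u1 p = 0) ->
  Rintegral mu setT u1 = 0.
Proof.
move=> du cu1 u0 u10; rewrite /Rintegral.
have iu1 := supported_integrable cu1 u10.
have c1 (y : R) : continuous (fun x => u1 (x, y)).
  move=> x; apply: (cvg_comp (fun t : R => (t, y)) u1 _ (cu1 (x, y))).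
  by apply: (@cvg_pair _ _ _ _ (nbhs x) (nbhs y)); [exact: cvg_id|exact: cvg_cst].
have c2 (x : R) : continuous (fun y => u1 (x, y)).
  move=> y; apply: (cvg_comp (fun t : R => (x, t)) u1 _ (cu1 (x, y))).
  by apply: (@cvg_pair _ _ _ _ (nbhs x) (nbhs y)); [exact: cvg_cst|exact: cvg_id].
have n1 (x y : R) : M < `|x| -> ~ box M (x, y).
  by move=> Mx [/=]; rewrite in_itv /= -ler_norml leNgt Mx.
have n2 (x y : R) : M < `|y| -> ~ box M (x, y).
  by move=> My [_ /=]; rewrite in_itv /= -ler_norml leNgt My.
have key : (\int[mu]_p (u1 p)%:E = 0)%E.
  case: b du => du.
  - rewrite -(integral12_prod_meas1 iu1) /fubini_F; apply: integral0_eq => x _.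
    apply: (@integral_derivative_eq0 M (fun y => u (x, y))).
    + by move=> y; exact: (is_derive_slice (du (x, y))).
    + exact: c2.
    + by move=> y My; apply/u0/n2.
    + by move=> y My; apply/u10/n2.
  - rewrite -(integral21_prod_meas1 iu1) /fubini_G; apply: integral0_eq => y _.
    apply: (@integral_derivative_eq0 M (fun x => u (x, y))).
    + by move=> x; exact: (is_derive_slice (du (x, y))).
    + exact: c1.
    + by move=> x Mx; apply/u0/n1.
    + by move=> x Mx; apply/u10/n1.
by rewrite key.
Qed.

End Plane.

(** * The integrable majorant *)

Section Kernel.
Variable R : realType.
Local Open Scope classical_set_scope.
Local Notation leb := (@lebesgue_measure R).
Local Notation mu := (@lebesgue_measure R \x @lebesgue_measure R)%E.

Let csq (c : R) : continuous (fun t : R => (t - c) ^+ 2).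
Proof.
by apply: continuous_exprn => x; apply: cvgB; [exact: cvg_id|exact: cvg_cst].
Qed.

(** An antiderivative is atan ((x - al) / r) / r, whose oscillation is less
than pi / r. *)
Lemma integral_cauchy_kernel (M r al : R) : 0 < r -> 0 < M ->
  (\int[leb]_(x in [set` `[- M, M]%R]) (((x - al) ^+ 2 + r ^+ 2)^-1)%:E
     <= (pi / r)%:E)%E.
Proof.
move=> r0 M0.
pose F x := r^-1 * atan ((x - al) / r).
have pos x : 0 < (x - al) ^+ 2 + r ^+ 2.
  by rewrite ltr_wpDl ?sqr_ge0// exprn_gt0.
have dF x : is_derive x (1 : R) F (((x - al) ^+ 2 + r ^+ 2)^-1).
  have dl : is_derive x (1 : R) (fun t => (t - al) / r) r^-1.
    have -> : (fun t => (t - al) / r) = r^-1 \*: (id - cst al).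
      by apply/funext => t; rewrite /= mulrC.
    by apply: is_derive_eq; rewrite subr0 [_ *: _]mulr1.
  have -> : F = r^-1 \*: (atan \o (fun t => (t - al) / r)) by [].
  apply: is_derive_eq.
  by rewrite /GRing.scale /=; field; rewrite !lt0r_neq0.
have cF : continuous F.
  by move=> x; apply/differentiable_continuous/derivable1_diffP; case: (dF x).
have ck : continuous (fun x => ((x - al) ^+ 2 + r ^+ 2)^-1).
  move=> x; apply: cvgV; first exact: lt0r_neq0.
  apply: cvgD; last exact: cvg_cst.
  exact: csq.
rewrite (continuous_FTC2 (F := F)).
- rewrite -EFinB lee_fin /F -mulrBr mulrC ler_wpM2r ?invr_ge0 ?ltW//.
  have := @atan_ltpi2 R ((M - al) / r); have := @atan_gtNpi2 R ((- M - al) / r).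
  lra.
- by rewrite gtrN.
- exact: continuous_subspaceT.
- split; first by move=> x _; case: (dF x).
  + exact/cvg_at_right_filter/cF.
  + exact/cvg_at_left_filter/cF.
- by move=> x _; rewrite derive1E; case: (dF x).
Qed.

Definition shifted_sqr_dist (r : R) (c p : R * R) : R :=
  (p.1 - c.1) ^+ 2 + (p.2 - c.2) ^+ 2 + r ^+ 2.

Lemma shifted_sqr_dist_gt0 r c p : 0 < r -> 0 < shifted_sqr_dist r c p.
Proof. by move=> r0; rewrite ltr_wpDl ?exprn_gt0// addr_ge0 ?sqr_ge0. Qed.

Lemma continuous_shifted_sqr_dist r c : continuous (shifted_sqr_dist r c).
Proof.
have cc (k : R) : continuous (fun _ : R * R => k) by move=> p; exact: cvg_cst.
do 2 (apply: continuousD_fun => //); apply: continuous_exprn => p.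
- by apply: cvgB; [exact: cvg_fst|exact: cvg_cst].
- by apply: cvgB; [exact: cvg_snd|exact: cvg_cst].
Qed.

(** Polar coordinates are avoided: with u and v the squared coordinates of p - c,
  (u + v + r^2)^2 >= (u + r^2) (v + r^2),
so that the kernel is at most a product of two one-variable kernels. *)
Lemma integral_plane_kernel (M r : R) (c : R * R) : 0 < r -> 0 < M ->
  (\int[mu]_(p in box M) (shifted_sqr_dist r c p ^- 2)%:E
     <= ((pi / r) ^+ 2)%:E)%E.
Proof.
case: c => al be r0 M0.
have r20 : 0 < r ^+ 2 by rewrite exprn_gt0.
pose k (c t : R) : R := ((t - c) ^+ 2 + r ^+ 2)^-1.
have k0 c t : 0 <= k c t by rewrite invr_ge0 addr_ge0// sqr_ge0.
have ck c : continuous (k c).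
  move=> x; apply: cvgV; first by rewrite lt0r_neq0// ltr_wpDl ?sqr_ge0.
  apply: cvgD; last exact: cvg_cst.
  exact: csq.
pose I : set R := [set` `[- M, M]%R].
pose K (c t : R) : R := k c t * \1_I t.
have K0 c t : 0 <= K c t by rewrite mulr_ge0.
have mK c : measurable_fun setT (K c).
  apply: measurable_funM; first exact: continuous_measurable_fun.
  by apply: measurable_indic; exact: measurable_itv.
have iK c : (\int[leb]_t (K c t)%:E <= (pi / r)%:E)%E.
  apply: le_trans (@integral_cauchy_kernel M r c r0 M0).
  rewrite [leRHS]integral_mkcond le_eqVlt; apply/orP; left; apply/eqP.
  apply: eq_integral => t _; rewrite /K /patch indicE.
  by case: (t \in _); rewrite ?mulr1 ?mulr0.
have mKE c : measurable_fun setT (EFin \o K c) by exact/measurable_EFinP.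
have mKK : measurable_fun setT (fun p : R * R => K al p.1 * K be p.2).
  apply: measurable_funM.
    exact: (measurableT_comp (mK al) measurable_fst).
  exact: (measurableT_comp (mK be) measurable_snd).
have ck2 : continuous (fun p => shifted_sqr_dist r (al, be) p ^- 2).
  apply: continuousV_fun => [p /=|].
    by rewrite lt0r_neq0// exprn_gt0// shifted_sqr_dist_gt0.
  by apply: continuous_exprn; exact: continuous_shifted_sqr_dist.
have mk2 := continuous_measurable_plane ck2.
have KK0 (p : R * R) : 0 <= K al p.1 * K be p.2 by rewrite mulr_ge0.
pose A : \bar R := (\int[mu]_p (K al p.1 * K be p.2)%:E)%E.
apply: (@le_trans _ _ A).
  apply: (@le_trans _ _ (\int[mu]_(p in box M) (K al p.1 * K be p.2)%:E)%E).
    apply: ge0_le_integral => //.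
    - exact: measurable_box.
    - by move=> p _; rewrite lee_fin invr_ge0 sqr_ge0.
    - by apply: measurable_funTS; exact/measurable_EFinP.
    - by apply: measurable_funTS; exact/measurable_EFinP.
    - move=> p [p1 p2]; rewrite /K !indicE !mem_set// !mulr1.
      rewrite lee_fin /k -invfM lef_pV2 ?posrE /shifted_sqr_dist /=.
      + have := sqr_ge0 (p.1 - al); have := sqr_ge0 (p.2 - be).
        move: ((p.2 - be) ^+ 2) ((p.1 - al) ^+ 2) (r ^+ 2) r20 => u v w w0 u0 v0.
        have := mulr_ge0 u0 v0; nra.
      + by rewrite exprn_gt0// ltr_wpDl// addr_ge0 ?sqr_ge0.
      + by rewrite mulr_gt0// ltr_wpDl// sqr_ge0.
  apply: ge0_subset_integral => //; first exact: measurable_box.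
    exact/measurable_EFinP.
  by move=> p _; rewrite lee_fin.
have -> : A = (\int[leb]_x \int[leb]_y (K al x * K be y)%:E)%E.
  have mE := (measurable_EFinP _ _).2 mKK.
  apply: (@fubini_tonelli1 _ _ _ _ _ leb leb
    (EFin \o (fun p : R * R => K al p.1 * K be p.2)) mE) => p.
  by rewrite lee_fin.
have -> : (\int[leb]_x \int[leb]_y (K al x * K be y)%:E =
    (\int[leb]_x (K al x)%:E) * \int[leb]_y (K be y)%:E)%E.
  rewrite -ge0_integralZr//.
  - apply: eq_integral => x _.
    rewrite -ge0_integralZl ?lee_fin//; last by move=> y _; rewrite lee_fin.
    exact: mKE.
  - exact: mKE.
  - by move=> y _; rewrite lee_fin.
  - by apply: integral_ge0 => y _; rewrite lee_fin.
by rewrite expr2 EFinM lee_pmul// integral_ge0// => y _; rewrite lee_fin.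
Qed.

End Kernel.

Section Majorant.
Variable R : realType.
Local Open Scope classical_set_scope.
Local Notation leb := (@lebesgue_measure R).
Local Notation mu := (@lebesgue_measure R \x @lebesgue_measure R)%E.

(** The form in which integrals are estimated: one kernel for each root, and a
constant on the support. *)
Lemma Rintegral_plane_le (M c r : R) (L : nat) (w : 'I_L -> R * R)
    (H : R * R -> R) :
  continuous H -> (forall p, ~ box M p -> H p = 0) ->
  0 < M -> 0 < r -> 0 <= c ->
  (forall p, box M p ->
    `|H p| <= c * (1 + \sum_(k < L) shifted_sqr_dist r (w k) p ^- 2)) ->
  `|Rintegral mu setT H| <= c * (fine (mu (box M)) + L%:R * (pi / r) ^+ 2).
Proof.
move=> cH H0 M0 r0 c0 leH.
have iH := supported_integrable cH H0.
have mB : measurable (box M) := measurable_box M.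
pose g k (p : R * R) := shifted_sqr_dist r (w k) p ^- 2.
have g0 k p : 0 <= g k p.
  by rewrite invr_ge0 exprn_ge0// ltW// shifted_sqr_dist_gt0.
have cg k : continuous (g k).
  apply: continuousV_fun => [p /=|].
    by rewrite lt0r_neq0// exprn_gt0// shifted_sqr_dist_gt0.
  by apply: continuous_exprn; exact: continuous_shifted_sqr_dist.
have mgT k : measurable_fun setT (g k) := continuous_measurable_plane (cg k).
have mg k : measurable_fun (box M) (EFin \o g k).
  by apply/measurable_EFinP; exact: measurable_funTS.
have mS : measurable_fun (box M) (fun p => (\sum_(k < L) (g k p)%:E)%E).
  by apply: emeasurable_sum; exact: mg.
have ig k : (\int[mu]_(p in box M) (g k p)%:E <= ((pi / r) ^+ 2)%:E)%E.
  exact: integral_plane_kernel.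
rewrite -lee_fin EFin_normr_Rintegral//.
apply: le_trans (le_abse_integral _ _ (measurable_int _ iH)) _ => //.
have -> : (\int[mu]_p `|(EFin \o H) p| = \int[mu]_(p in box M) `|(H p)%:E|)%E.
  rewrite [RHS]integral_mkcond; apply: eq_integral => p _.
  rewrite /patch; case: ifPn => // /negP pM.
  by rewrite /= H0 ?normr0 // => /mem_set.
have -> : (c * (fine (mu (box M)) + L%:R * (pi / r) ^+ 2))%:E =
    (c%:E * (mu (box M) + \sum_(k < L) ((pi / r) ^+ 2)%:E))%E.
  rewrite EFinM EFinD fineK; last by rewrite ge0_fin_numE// box_lty.
  by rewrite sumEFin sumr_const card_ord mulr_natl.
apply: (@le_trans _ _ (\int[mu]_(p in box M)
    (c%:E * (1 + \sum_(k < L) (g k p)%:E)))%E).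
  apply: ge0_le_integral => //.
  - apply: measurableT_comp => //; apply: measurable_funTS.
    exact: (measurable_int _ iH).
  - by apply: measurable_funeM; apply: emeasurable_funD.
  - by move=> p pM; rewrite sumEFin -EFinD -EFinM lee_fin leH.
rewrite ge0_integralZl_EFin//; last 2 first.
- by move=> p _; rewrite sumEFin -EFinD lee_fin addr_ge0// sumr_ge0.
- exact: emeasurable_funD.
apply: lee_wpmul2l => //.
rewrite ge0_integralD//; last first.
  by move=> p _; rewrite sumEFin lee_fin sumr_ge0.
rewrite integral_cst// mul1e leeD2l//.
rewrite ge0_integral_sum//; first exact: lee_sum.
by move=> k p _; rewrite lee_fin.
Qed.

End Majorant.

(** * Two derivatives in a fixed direction, with bounds *)

Section Jets.
Variable R : realType.
Local Open Scope classical_set_scope.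
Local Open Scope ring_scope.
Local Notation mu := (@lebesgue_measure R \x @lebesgue_measure R)%E.
Implicit Types (v : R * R) (u : R * R -> R).

Definition jet v u u1 u2 : Prop :=
  [/\ continuous u, continuous u1, continuous u2,
      forall p, is_derive p v u (u1 p) & forall p, is_derive p v u1 (u2 p)].

Lemma is_derive_mul v u w p du dw :
  is_derive p v u du -> is_derive p v w dw ->
  is_derive p v (fun q => u q * w q) (du * w p + u p * dw).
Proof.
move=> hu hw; have -> : (fun q => u q * w q) = u * w by [].
by apply: is_derive_eq; rewrite /GRing.scale /= addrC [du * _]mulrC.
Qed.

Lemma jet_cst v c : jet v (fun=> c) (fun=> 0) (fun=> 0).
Proof.
have D (k : R) p : is_derive p v (fun=> k) 0 by exact: is_derive_cst.
by split => // p; exact: cvg_cst.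
Qed.

Lemma jetD v u u1 u2 w w1 w2 : jet v u u1 u2 -> jet v w w1 w2 ->
  jet v (fun p => u p + w p) (fun p => u1 p + w1 p) (fun p => u2 p + w2 p).
Proof.
move=> [cu cu1 cu2 du du1] [cw cw1 cw2 dw dw1].
split; [exact: continuousD_fun..|by move=> p; exact: is_deriveD|].
by move=> p; exact: is_deriveD.
Qed.

Lemma jetM v u u1 u2 w w1 w2 : jet v u u1 u2 -> jet v w w1 w2 ->
  jet v (fun p => u p * w p) (fun p => u1 p * w p + u p * w1 p)
    (fun p => (u2 p * w p + u1 p * w1 p) + (u1 p * w1 p + u p * w2 p)).
Proof.
move=> [cu cu1 cu2 du du1] [cw cw1 cw2 dw dw1]; split.
- exact: continuousM_fun.
- by apply: continuousD_fun; exact: continuousM_fun.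
- by apply: continuousD_fun; apply: continuousD_fun; exact: continuousM_fun.
- by move=> p; exact: is_derive_mul.
- by move=> p; apply: is_deriveD; exact: is_derive_mul.
Qed.

Lemma is_derive_inv v u p du : u p != 0 -> is_derive p v u du ->
  is_derive p v (fun q => (u q)^-1) (- du * ((u p)^-1 * (u p)^-1)).
Proof.
move=> u0 [hu <-]; split; first exact: derivableV.
by rewrite deriveV// /GRing.scale /= expr2 invfM mulNr mulrC mulNr.
Qed.

Lemma jetV v u u1 u2 : (forall p, u p != 0) -> jet v u u1 u2 ->
  jet v (fun p => (u p)^-1) (fun p => - u1 p * ((u p)^-1 * (u p)^-1))
    (fun p => - u2 p * ((u p)^-1 * (u p)^-1)
      + - u1 p * (- u1 p * ((u p)^-1 * (u p)^-1) * (u p)^-1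
          + (u p)^-1 * (- u1 p * ((u p)^-1 * (u p)^-1)))).
Proof.
move=> u0 [cu cu1 cu2 du du1].
have cV := continuousV_fun u0 cu.
have cVV := continuousM_fun cV cV.
have cN1 : continuous (fun p => - u1 p) by move=> p; apply: cvgN; exact: cu1.
have cN2 : continuous (fun p => - u2 p) by move=> p; apply: cvgN; exact: cu2.
have dV p := is_derive_inv (u0 p) (du p).
split => //; first exact: continuousM_fun.
  apply: continuousD_fun; apply: continuousM_fun => //.
  apply: continuousD_fun; apply: continuousM_fun => //; exact: continuousM_fun.
by move=> p; apply: is_derive_mul; exact: is_derive_mul.
Qed.

(** Each derivative costs a factor c K relative to the size U. With this
normalization the constants of a product add up ([dominatedM]), because
  c^2 + 2 c e + e^2 = (c + e)^2.
The functions K and U carry no regularity, so that K can be the inverse distance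
to the nearest root. *)
Definition dominated v (c : R) (K U u : R * R -> R) : Prop :=
  exists u1 u2, jet v u u1 u2 /\
    forall p, [/\ `|u p| <= U p, `|u1 p| <= c * U p * K p
                & `|u2 p| <= c ^+ 2 * U p * K p ^+ 2].

Lemma dominated_cst v (k : R) K : dominated v 0 K (fun=> `|k|) (fun=> k).
Proof.
exists (fun=> 0), (fun=> 0); split; first exact: jet_cst.
by move=> p; rewrite normr0 expr0n !mul0r.
Qed.

Lemma dominatedD v c K U W u w :
  dominated v c K U u -> dominated v c K W w ->
  dominated v c K (fun p => U p + W p) (fun p => u p + w p).
Proof.
move=> [u1 [u2 [ju bu]]] [w1 [w2 [jw bw]]].
eexists _, _; split; first exact: jetD ju jw.
move=> p; have [u0 u01 u02] := bu p; have [w0 w01 w02] := bw p.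
rewrite mulrDr !mulrDl mulrDr mulrDl.
by split; rewrite (le_trans (ler_normD _ _))// lerD.
Qed.

Lemma dominatedM v c e K U W u w : (forall p, 0 <= K p) -> 0 <= c -> 0 <= e ->
  dominated v c K U u -> dominated v e K W w ->
  dominated v (c + e) K (fun p => U p * W p) (fun p => u p * w p).
Proof.
move=> K0 c0 e0 [u1 [u2 [ju bu]]] [w1 [w2 [jw bw]]].
eexists _, _; split; first exact: jetM ju jw.
move=> p; have [u0 u01 u02] := bu p; have [w0 w01 w02] := bw p.
have mul a b a' b' : `|a| <= a' -> `|b| <= b' -> `|a * b| <= a' * b'.
  by move=> *; rewrite normrM ler_pM.
split; first exact: mul.
- have -> : (c + e) * (U p * W p) * K p
    = c * U p * K p * W p + U p * (e * W p * K p) by ring.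
  by rewrite (le_trans (ler_normD _ _))// lerD// mul.
- have -> : (c + e) ^+ 2 * (U p * W p) * K p ^+ 2
    = (c ^+ 2 * U p * K p ^+ 2 * W p + c * U p * K p * (e * W p * K p))
      + (c * U p * K p * (e * W p * K p) + U p * (e ^+ 2 * W p * K p ^+ 2)) by ring.
  by do 2 (rewrite (le_trans (ler_normD _ _))// lerD//); exact: mul.
Qed.

Lemma dominatedX v c K U u n : (forall p, 0 <= K p) -> 0 <= c ->
  dominated v c K U u ->
  dominated v (n%:R * c) K (fun p => U p ^+ n) (fun p => u p ^+ n).
Proof.
move=> K0 c0 du; elim: n => [|n IHn].
  rewrite mul0r; have := @dominated_cst v 1 K.
  by rewrite normr1.
rewrite -natr1 mulrDl mul1r addrC.
under [X in dominated _ _ _ X]eq_fun do rewrite exprS.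
under [X in dominated _ _ _ _ X]eq_fun do rewrite exprS.
by apply: dominatedM => //; rewrite mulr_ge0.
Qed.

Lemma dominated_prod v K (I : Type) (s : seq I) (c : I -> R)
    (U u : I -> R * R -> R) : (forall p, 0 <= K p) -> (forall i, 0 <= c i) ->
  (forall i, dominated v (c i) K (U i) (u i)) ->
  dominated v (\sum_(i <- s) c i) K (fun p => \prod_(i <- s) U i p)
    (fun p => \prod_(i <- s) u i p).
Proof.
move=> K0 c0 du; elim: s => [|i s IHs].
  rewrite big_nil.
  under [X in dominated _ _ _ X]eq_fun do rewrite big_nil.
  under [X in dominated _ _ _ _ X]eq_fun do rewrite big_nil.
  by have := @dominated_cst v 1 K; rewrite normr1.
rewrite big_cons.
under [X in dominated _ _ _ X]eq_fun do rewrite big_cons.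
under [X in dominated _ _ _ _ X]eq_fun do rewrite big_cons.
by apply: dominatedM => //; exact: sumr_ge0.
Qed.

(** The second derivative of 1 / u is - u2 / u^2 + 2 u1^2 / u^3, which is at most
3 c^2 K^2 / u, and 3 <= 2^2. *)
Lemma dominatedV v c K u : (forall p, 0 < u p) -> 0 <= c ->
  dominated v c K u u ->
  dominated v (2 * c) K (fun p => (u p)^-1) (fun p => (u p)^-1).
Proof.
move=> u0 c0 [u1 [u2 [ju bu]]].
have un0 p : u p != 0 by rewrite lt0r_neq0.
eexists _, _; split; first exact: jetV un0 ju.
move=> p; have [_ b1 b2] := bu p.
have Vp : 0 < (u p)^-1 by rewrite invr_gt0.
have VV : 0 <= (u p)^-1 * (u p)^-1 by rewrite mulr_ge0 ?ltW.
have Ku : 0 <= c * u p * K p by apply: le_trans b1.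
have e1 : c * K p * (u p)^-1 = c * u p * K p * ((u p)^-1 * (u p)^-1).
  by field; exact: un0.
have cK : 0 <= c * K p * (u p)^-1 by rewrite e1 mulr_ge0.
have b1' : `|- u1 p * ((u p)^-1 * (u p)^-1)| <= c * K p * (u p)^-1.
  by rewrite e1 normrM normrN (ger0_norm VV) ler_wpM2r.
split.
- by rewrite gtr0_norm.
- by apply: (le_trans b1'); rewrite -subr_ge0 [X in 0 <= X](_ : _ = c * K p * (u p)^-1) //; ring.
- have b2' : `|- u2 p * ((u p)^-1 * (u p)^-1)| <= c ^+ 2 * K p ^+ 2 * (u p)^-1.
    have -> : c ^+ 2 * K p ^+ 2 * (u p)^-1
      = c ^+ 2 * u p * K p ^+ 2 * ((u p)^-1 * (u p)^-1) by field; exact: un0.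
    by rewrite normrM normrN (ger0_norm VV) ler_wpM2r.
  have b3 : `|- u1 p * (- u1 p * ((u p)^-1 * (u p)^-1) * (u p)^-1
      + (u p)^-1 * (- u1 p * ((u p)^-1 * (u p)^-1)))|
      <= 2 * (c ^+ 2 * K p ^+ 2 * (u p)^-1).
    have -> : - u1 p * (- u1 p * ((u p)^-1 * (u p)^-1) * (u p)^-1
      + (u p)^-1 * (- u1 p * ((u p)^-1 * (u p)^-1)))
      = 2 * ((- u1 p * ((u p)^-1 * (u p)^-1)) * (- u1 p * ((u p)^-1 * (u p)^-1)) * u p).
      by field; exact: un0.
    have -> : c ^+ 2 * K p ^+ 2 * (u p)^-1
      = (c * K p * (u p)^-1) * (c * K p * (u p)^-1) * u p.
      by field; exact: un0.
    rewrite normrM normr_nat ler_pM2l// normrM (gtr0_norm (u0 p)) ler_wpM2r ?(ltW (u0 p))//.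
    by rewrite normrM ler_pM.
  apply: (le_trans (ler_normD _ _)); apply: (le_trans (lerD b2' b3)).
  rewrite -subr_ge0 [X in 0 <= X](_ : _ = c ^+ 2 * K p ^+ 2 * (u p)^-1); last by ring.
  by apply: mulr_ge0 (ltW Vp); apply: mulr_ge0; exact: sqr_ge0.
Qed.

Lemma open_setC_box (M : R) : open (~` box M).
Proof.
apply: closed_openC; apply: compact_closed; first exact: norm_hausdorff.
exact: compact_box.
Qed.

Lemma is_derive_off_box (M : R) v u p d : (forall q, ~ box M q -> u q = 0) ->
  is_derive p v u d -> ~ box M p -> d = 0.
Proof.
move=> u0 [_ <-] Mp.
have np : \forall q \near p, u q = cst 0 q.
  by near=> q; apply: u0; near: q; exact: open_nbhs_nbhs (conj (@open_setC_box M) Mp).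
by rewrite (near_eq_derive _ np) derive_cst.
Unshelve. all: by end_near. Qed.

(** The integrand is the derivative of E G1 - E1 G, which vanishes off the box
together with G and its derivatives. *)
Lemma green (b : bool) (M : R) (E E1 E2 G G1 G2 : R * R -> R) :
  jet (unit_dir R b) E E1 E2 -> jet (unit_dir R b) G G1 G2 ->
  (forall p, ~ box M p -> G p = 0) ->
  [/\ continuous (fun p => E p * G2 p - E2 p * G p),
      forall p, ~ box M p -> E p * G2 p - E2 p * G p = 0
    & Rintegral mu setT (fun p => E p * G2 p - E2 p * G p) = 0].
Proof.
move=> [cE cE1 cE2 dE dE1] [cG cG1 cG2 dG dG1] G0.
have G10 p : ~ box M p -> G1 p = 0 by exact: is_derive_off_box (dG p).
have G20 p : ~ box M p -> G2 p = 0 by exact: is_derive_off_box (dG1 p).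
have cN : continuous (fun p => - (E2 p * G p)).
  by move=> p; apply: cvgN; exact: (@continuousM_fun _ _ _ _ cE2 cG).
have cW : continuous (fun p => E p * G2 p - E2 p * G p).
  by apply: continuousD_fun => //; exact: continuousM_fun.
have W0 p : ~ box M p -> E p * G2 p - E2 p * G p = 0.
  by move=> Mp; rewrite G20// G0// !mulr0 subr0.
split => //.
apply: (@integral_partial_eq0 _ b M (fun p => E p * G1 p - E1 p * G p)) => //.
- move=> p.
  apply: (is_derive_eq (is_deriveB (is_derive_mul (dE p) (dG1 p))
                                   (is_derive_mul (dE1 p) (dG p)))).
  by ring.
- by move=> p Mp; rewrite G10// G0// !mulr0 subr0.
Qed.

End Jets.

(** * The phase as a harmonic function *)

Section Phase.
Variable R : realType.
Local Open Scope classical_set_scope.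
Local Open Scope complex_scope.
Local Open Scope ring_scope.
Implicit Types (v p : R * R) (u : R * R -> R) (f g : {poly R[i]}).
Local Notation Re := (@complex.Re R).
Local Notation Im := (@complex.Im R).
Local Notation toC := (@complex_of_pair R).

Lemma Re_mul (x y : R[i]) : Re (x * y) = Re x * Re y - Im x * Im y.
Proof. by case: x y => [a b] [c d]. Qed.

Lemma Im_mul (x y : R[i]) : Im (x * y) = Re x * Im y + Im x * Re y.
Proof. by case: x y => [a b] [c d]. Qed.

Lemma Re_add (x y : R[i]) : Re (x + y) = Re x + Re y.
Proof. by case: x y => [a b] [c d]. Qed.

Lemma Im_add (x y : R[i]) : Im (x + y) = Im x + Im y.
Proof. by case: x y => [a b] [c d]. Qed.

Lemma continuous_horner_plane f :
  continuous (fun p => Re f.[toC p]) /\ continuous (fun p => Im f.[toC p]).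
Proof.
elim/poly_ind: f => [|f c [cR cI]].
  by split => p; under eq_fun do rewrite horner0; exact: cvg_cst.
have c1 : continuous (fst : R * R -> R) by move=> p; exact: cvg_fst.
have c2 : continuous (snd : R * R -> R) by move=> p; exact: cvg_snd.
have cc (k : R) : continuous (fun _ : R * R => k) by move=> p; exact: cvg_cst.
have cN : continuous (fun p => - Im f.[toC p]) by move=> p; apply: cvgN; exact: cI.
split.
- under eq_fun do rewrite hornerMXaddC Re_add Re_mul -mulNr.
  by do 2 (apply: continuousD_fun => //); exact: continuousM_fun.
- under eq_fun do rewrite hornerMXaddC Im_add Im_mul.
  by do 2 (apply: continuousD_fun => //); exact: continuousM_fun.
Qed.

Lemma is_derive_fst v p : is_derive p v (fst : R * R -> R) v.1.
Proof.
have H : (fun h : R => h^-1 *: ((h *: v + p).1 - p.1)) @ 0^' --> v.1.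
  apply: cvg_near_cst; near=> h => /=.
  rewrite addrK /GRing.scale /= mulKf//.
  by near: h; exact: nbhs_dnbhs_neq.
by split; [apply/cvg_ex; exists v.1|apply: cvg_lim].
Unshelve. all: by end_near. Qed.

Lemma is_derive_snd v p : is_derive p v (snd : R * R -> R) v.2.
Proof.
have H : (fun h : R => h^-1 *: ((h *: v + p).2 - p.2)) @ 0^' --> v.2.
  apply: cvg_near_cst; near=> h => /=.
  rewrite addrK /GRing.scale /= mulKf//.
  by near: h; exact: nbhs_dnbhs_neq.
by split; [apply/cvg_ex; exists v.2|apply: cvg_lim].
Unshelve. all: by end_near. Qed.

(** The chain rule for z |-> f(z): the derivative along v is f'(z) v, with v read
as a complex number. Multiplying f' by the constant polynomial v keeps the
derivative in the same class of functions, so that it can be differentiated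
again. *)
Lemma is_derive_horner_plane f v p :
  is_derive p v (fun q => Re f.[toC q]) (Re (f^`() * (toC v)%:P).[toC p]) /\
  is_derive p v (fun q => Im f.[toC q]) (Im (f^`() * (toC v)%:P).[toC p]).
Proof.
elim/poly_ind: f => [|f c [dR dI]].
  rewrite deriv0 mul0r horner0.
  by split; under eq_fun do rewrite horner0; exact: is_derive_cst.
have dx := is_derive_fst v p; have dy := is_derive_snd v p.
have dN : is_derive p v (fun q => - Im f.[toC q])
    (- Im (f^`() * (toC v)%:P).[toC p]) by exact: is_deriveN.
have dc (k : R) : is_derive p v (fun=> k) 0 by exact: is_derive_cst.
rewrite derivD derivM derivX derivC addr0 mulr1 !hornerE /=.
rewrite !hornerE in dR dI dN.
split.
- under eq_fun do rewrite hornerMXaddC Re_add Re_mul -mulNr.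
  apply: (is_derive_eq (is_deriveD (is_deriveD (is_derive_mul dR dx) (is_derive_mul dN dy)) (dc _))).
  by rewrite !(Re_mul, Im_mul, Re_add, Im_add) /=; ring.
- under eq_fun do rewrite hornerMXaddC Im_add Im_mul.
  apply: (is_derive_eq (is_deriveD (is_deriveD (is_derive_mul dR dy) (is_derive_mul dI dx)) (dc _))).
  by rewrite !(Re_mul, Im_mul, Re_add, Im_add) /=; ring.
Qed.

Definition phase f p : R := 2 * pi * Re f.[toC p] + 2 * pi * Im f.[toC p].

Lemma jet_phase f v : jet v (phase f)
  (phase (f^`() * (toC v)%:P)) (phase (f^`()^`() * (toC v)%:P * (toC v)%:P)).
Proof.
have cp g : continuous (phase g).
  have [cR cI] := continuous_horner_plane g.
  have cc : continuous (fun _ : R * R => 2 * pi : R) by move=> p; exact: cvg_cst.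
  by apply: continuousD_fun; exact: continuousM_fun.
have dp g p : is_derive p v (phase g) (phase (g^`() * (toC v)%:P) p).
  have [dR dI] := is_derive_horner_plane g v p.
  exact: is_deriveD (is_deriveZ (2 * pi) dR) (is_deriveZ (2 * pi) dI).
split => // p; have := dp (f^`() * (toC v)%:P) p.
by rewrite derivM derivC mulr0 addr0.
Qed.

(** Brings the chain rule for directional derivatives down to the chain rule for
functions of one variable. *)
Lemma is_derive_line u v p d :
  is_derive p v u d <-> is_derive (0 : R) (1 : R) (fun h => u (h *: v + p)) d.
Proof.
have E : (fun h : R => h^-1 *: ((u \o shift p) (h *: v) - u p)) =
  (fun h : R => h^-1 *: (((fun h => u (h *: v + p)) \o shift (0 : R)) (h *: (1 : R))
    - u ((0 : R) *: v + p))).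
  apply/funext => h /=; rewrite scale0r add0r addr0.
  by congr (_ *: (u (_ *: v + p) - _)); rewrite [RHS]mulr1.
by split => -[du dE]; split; move: du dE; rewrite /derivable /derive E.
Qed.

Lemma is_derive_chain (F : R -> R) u v p (d D : R) :
  is_derive (u p) (1 : R) F D -> is_derive p v u d ->
  is_derive p v (fun q => F (u q)) (D * d).
Proof.
move=> dF /is_derive_line du; apply/is_derive_line.
apply: (@is_derive1_comp _ F (fun h : R => u (h *: v + p))) => //.
by rewrite scale0r add0r.
Qed.

Lemma jet_cos v u u1 u2 : jet v u u1 u2 ->
  jet v (fun p => cos (u p)) (fun p => - sin (u p) * u1 p)
    (fun p => - cos (u p) * u1 p * u1 p + - sin (u p) * u2 p).
Proof.
move=> [cu cu1 cu2 du du1].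
have cC : continuous (fun p => - cos (u p)).
  move=> p; apply: cvgN; apply: (cvg_comp u cos (cu p)); exact: continuous_cos.
have cC' : continuous (fun p => cos (u p)).
  move=> p; apply: (cvg_comp u cos (cu p)); exact: continuous_cos.
have cS : continuous (fun p => - sin (u p)).
  move=> p; apply: cvgN; apply: (cvg_comp u sin (cu p)); exact: continuous_sin.
have dS p : is_derive p v (fun q => - sin (u q)) (- cos (u p) * u1 p).
  by rewrite mulNr; apply: is_deriveN; exact: is_derive_chain.
split => //.
- exact: continuousM_fun.
- by apply: continuousD_fun; apply: continuousM_fun => //; exact: continuousM_fun.
- by move=> p; exact: is_derive_chain.
- by move=> p; exact: is_derive_mul.
Qed.

Lemma jet_sin v u u1 u2 : jet v u u1 u2 ->
  jet v (fun p => sin (u p)) (fun p => cos (u p) * u1 p)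
    (fun p => - sin (u p) * u1 p * u1 p + cos (u p) * u2 p).
Proof.
move=> [cu cu1 cu2 du du1].
have cC : continuous (fun p => cos (u p)).
  move=> p; apply: (cvg_comp u cos (cu p)); exact: continuous_cos.
have cS' : continuous (fun p => sin (u p)).
  move=> p; apply: (cvg_comp u sin (cu p)); exact: continuous_sin.
have cS : continuous (fun p => - sin (u p)).
  move=> p; apply: cvgN; exact: cS'.
have dS p : is_derive p v (fun q => cos (u q)) (- sin (u p) * u1 p).
  exact: is_derive_chain.
split => //.
- exact: continuousM_fun.
- by apply: continuousD_fun; apply: continuousM_fun => //; exact: continuousM_fun.
- by move=> p; exact: is_derive_chain.
- by move=> p; exact: is_derive_mul.
Qed.

Definition sqrc (z : R[i]) : R := Re z ^+ 2 + Im z ^+ 2.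

(** The second derivatives of the phase along 1 and i are the phases of f'' and
of i^2 f'' = - f''. *)
Lemma phase_laplacian0 g p (e := fun b => (toC (unit_dir R b))%:P) :
  phase (g * e false * e false) p + phase (g * e true * e true) p = 0.
Proof.
rewrite /phase /e !hornerE !(Re_mul, Im_mul) /=; ring.
Qed.

(** The first derivatives are 2 pi (Re f' + Im f') and 2 pi (Re f' - Im f'). *)
Lemma phase_gradient g p (e := fun b => (toC (unit_dir R b))%:P) :
  phase (g * e false) p ^+ 2 + phase (g * e true) p ^+ 2
    = 8 * pi ^+ 2 * sqrc g.[toC p].
Proof.
rewrite /phase /sqrc /e !hornerE !(Re_mul, Im_mul) /=; ring.
Qed.

Section Waves.
Variable f : {poly R[i]}.
Local Notation th := (phase f).
Let fx b := phase (f^`() * (complex_of_pair (unit_dir R b))%:P).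
Let fxx b := phase (f^`()^`() * (complex_of_pair (unit_dir R b))%:P
                     * (complex_of_pair (unit_dir R b))%:P).

(** Solutions of (Laplacian) E = - |grad phase|^2 E. Since the phase is harmonic,
its cosine and its sine are such solutions; treating them separately keeps the
analysis real-valued. *)
Definition is_wave (E : R * R -> R) := exists E1 E2 : bool -> R * R -> R,
  [/\ forall b, jet (unit_dir R b) E (E1 b) (E2 b), forall p, `|E p| <= 1
    & forall p, E2 false p + E2 true p
        = - (8 * pi ^+ 2 * sqrc (f^`()).[complex_of_pair p] * E p)].

Lemma is_wave_cos : is_wave (fun p => cos (th p)).
Proof.
exists (fun b p => - sin (th p) * fx b p), (fun b p =>
  - cos (th p) * fx b p * fx b p + - sin (th p) * fxx b p).
split => [b|p|p]; first exact/jet_cos/jet_phase.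
  by rewrite ler_norml cos_geN1 cos_le1.
rewrite -phase_gradient.
have : fxx false p + fxx true p = 0 by exact: phase_laplacian0.
rewrite -/(fx false) -/(fx true) => /eqP; rewrite addr_eq0 => /eqP ->; ring.
Qed.

Lemma is_wave_sin : is_wave (fun p => sin (th p)).
Proof.
exists (fun b p => cos (th p) * fx b p), (fun b p =>
  - sin (th p) * fx b p * fx b p + cos (th p) * fxx b p).
split => [b|p|p]; first exact/jet_sin/jet_phase.
  by rewrite ler_norml sin_geN1 sin_le1.
rewrite -phase_gradient.
have : fxx false p + fxx true p = 0 by exact: phase_laplacian0.
rewrite -/(fx false) -/(fx true) => /eqP; rewrite addr_eq0 => /eqP ->; ring.
Qed.

Lemma echar_horner p :
  echar f.[complex_of_pair p] = (cos (th p) +i* sin (th p))%C.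
Proof.
rewrite /phase cosD sinD /echar /cis; apply/eqP; rewrite eq_complex.
by rewrite Re_mul Im_mul /= [X in _ && (X == _)]addrC !eqxx.
Qed.

End Waves.

End Phase.

(** * Root clusters and the lower bound for the derivative *)

Section Clusters.
Variable R : realType.
Local Open Scope classical_set_scope.
Local Open Scope complex_scope.
Local Open Scope ring_scope.
Local Notation Re := (@complex.Re R).
Local Notation Im := (@complex.Im R).

Lemma sqrc_ge0 (z : R[i]) : 0 <= sqrc z.
Proof. by rewrite addr_ge0 ?sqr_ge0. Qed.

Lemma sqrc_gt0 (z : R[i]) : (0 < sqrc z) = (z != 0).
Proof.
case: z => x y; rewrite lt0r sqrc_ge0 andbT /sqrc /= paddr_eq0 ?sqr_ge0//.
by rewrite !sqrf_eq0 eq_complex.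
Qed.

Lemma sqrcM (x y : R[i]) : sqrc (x * y) = sqrc x * sqrc y.
Proof. by rewrite /sqrc Re_mul Im_mul; ring. Qed.

Lemma sqrc1 : sqrc (1 : R[i]) = 1.
Proof. by rewrite /sqrc /= expr1n expr0n addr0. Qed.

Lemma sqrcX (x : R[i]) n : sqrc (x ^+ n) = sqrc x ^+ n.
Proof. by elim: n => [|n IHn]; rewrite ?expr0 ?sqrc1// !exprS sqrcM IHn. Qed.

Lemma sqrc_prod (I : Type) (s : seq I) (P : pred I) (F : I -> R[i]) :
  sqrc (\prod_(i <- s | P i) F i) = \prod_(i <- s | P i) sqrc (F i).
Proof. exact: (big_morph _ sqrcM sqrc1). Qed.

Lemma cabsE (z : R[i]) : cabs z = Num.sqrt (sqrc z).
Proof. by case: z. Qed.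

Definition pair_of_complex (z : R[i]) : R * R := (Re z, Im z).

Local Notation sdist r z := (shifted_sqr_dist r (pair_of_complex z)).

Lemma sdist0E (z : R[i]) p : sdist 0 z p = sqrc (complex_of_pair p - z).
Proof. by rewrite /shifted_sqr_dist expr0n addr0; case: z. Qed.

Lemma sdist_ge0 (r : R) z p : 0 <= sdist r z p.
Proof. by rewrite !addr_ge0 ?sqr_ge0. Qed.

Lemma sdistE (r : R) z p : sdist r z p = sdist 0 z p + r ^+ 2.
Proof. by rewrite /shifted_sqr_dist expr0n addr0. Qed.

(** The multiplicities add up to d - 1, so that constants depending on their sum
depend on d only. *)
Lemma deriv_factorization_degree (d L : nat) (f : {poly R[i]}) (a : R[i])
    (w : 'I_L -> R[i]) (m : 'I_L -> nat) : (2 <= d)%N -> size f = d.+1 ->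
  f^`() = a *: \prod_(j < L) ('X - (w j)%:P) ^+ m j ->
  a != 0 /\ (\sum_j m j).+1 = d.
Proof.
move=> d2 sf df.
have fd : f^`()`_d.-1 != 0.
  rewrite coef_deriv prednK ?(ltn_trans _ d2)// mulrn_eq0 negb_or.
  rewrite -lt0n (ltn_trans _ d2)//= -[d]/(d.+1.-1) -sf -lead_coefE lead_coef_eq0.
  by rewrite -size_poly_gt0 sf.
have sd : size f^`() = d.
  apply/eqP; rewrite eqn_leq -ltnS -sf lt_size_deriv -?size_poly_gt0 ?sf//=.
  rewrite leqNgt; apply: contra fd => sd; rewrite nth_default// -ltnS prednK//.
  exact: ltn_trans d2.
have a0 : a != 0.
  apply/eqP => a0; move: fd; rewrite df a0 scale0r coef0 eqxx //.
split => //; rewrite -[RHS]sd df size_scale// size_prod; last first.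
  by move=> j _; rewrite expf_neq0// polyXsubC_eq0.
under [in RHS]eq_bigr do rewrite size_exp_XsubC -addn1.
by rewrite big_split /= sum1_card -addSn addnK.
Qed.

Section ClusterTerms.
Variables (L : nat) (a : R[i]) (w : 'I_L -> R[i]) (m : 'I_L -> nat).
Hypotheses (a0 : a != 0) (winj : injective w).

Lemma min_cluster_attained (j : 'I_L) : exists2 C : {set 'I_L},
  j \in C & min_cluster_term a w m j = cluster_term a w m j C.
Proof.
rewrite /min_cluster_term.
apply: (big_ind (fun x => exists2 C : {set 'I_L}, j \in C & x = cluster_term a w m j C)).
- by exists finset.setT; rewrite ?inE.
- move=> x y [C jC ->] [C' jC' ->]; rewrite /Order.min.
  by case: ifP => _; [exists C|exists C'].
- by move=> C jC; exists C.
Qed.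

Lemma cluster_product_neq0 (j : 'I_L) (C : {set 'I_L}) : j \in C ->
  a * \prod_(k < L | k \notin C) (w j - w k) ^+ m k != 0.
Proof.
move=> jC; rewrite mulf_neq0//; apply/prodf_neq0 => k kC.
rewrite expf_neq0// subr_eq0; apply: contraNneq kC => /winj <-.
by rewrite jC.
Qed.

Lemma cluster_term_gt0 (j : 'I_L) (C : {set 'I_L}) : j \in C ->
  0 < cluster_term a w m j C.
Proof.
move=> jC; rewrite powR_gt0// div1r invr_gt0 cabsE sqrtr_gt0 sqrc_gt0.
exact: cluster_product_neq0.
Qed.

Lemma max_min_cluster_gt0 : (0 < L)%N -> 0 < max_min_cluster_term a w m.
Proof.
move=> L0; have [C jC mE] := min_cluster_attained (Ordinal L0).
apply: (lt_le_trans (cluster_term_gt0 jC)); rewrite -mE.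
exact: le_bigmax.
Qed.

(** The bound cluster_term <= T for the minimizing cluster, freed of the real
exponent 2 / (S(C) + 1) and of the inverse. *)
Lemma max_min_cluster_witness (j : 'I_L) : exists2 C : {set 'I_L}, j \in C &
  1 <= sqrc (a * \prod_(k < L | k \notin C) (w j - w k) ^+ m k)
       * max_min_cluster_term a w m ^+ (cluster_mult m C).+1.
Proof.
have [C jC mE] := min_cluster_attained j; exists C => //.
have : cluster_term a w m j C <= max_min_cluster_term a w m.
  by rewrite -mE; exact: le_bigmax.
rewrite /cluster_term; set X := (a * _); set S := cluster_mult m C.
have X0 : 0 < sqrc X by rewrite sqrc_gt0; exact: cluster_product_neq0.
have cX0 : 0 < cabs X by rewrite cabsE sqrtr_gt0.
set T := max_min_cluster_term a w m => le.
have T0 : 0 <= T by apply: (le_trans (powR_ge0 _ _) le).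
have : (1 / cabs X) `^ (2 / (S%:R + 1)) ^+ S.+1 <= T ^+ S.+1.
  by rewrite lerXn2r ?nnegrE ?powR_ge0.
rewrite -powR_mulrn ?powR_ge0// -powRrM natr1 divfK ?pnatr_eq0//.
rewrite powR_mulrn ?divr_ge0 ?(ltW cX0)// div1r exprVn cabsE sqr_sqrtr ?(ltW X0)//.
by rewrite -[leLHS]mul1r ler_pdivrMr// mulrC.
Qed.

End ClusterTerms.
Variables (L : nat) (a : R[i]) (w : 'I_L -> R[i]) (m : 'I_L -> nat).

(** At r = 0 this is |f'|^2; for r > 0 every factor |z - w_k|^2 is replaced by
|z - w_k|^2 + r^2, which removes the zeros. *)
Definition smeared_sqr_mod (r : R) (p : R * R) : R :=
  sqrc a * \prod_(k < L) sdist r (w k) p ^+ m k.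

(** With T = r^2 the hypothesis says that |a \prod_(k notin C) (w_j - w_k)^(m_k)|
is at least r^-(S+1), where S = S(C). As w_j is nearest to p, the factors of the
smeared modulus satisfy s_k >= |w_j - w_k|^2 / 4 for k outside C and s_k >= s_j
for k in C; hence it is at least 4^-D r^(-2(S+1)) s_j^S. Finally s_j >= r^2 and
S >= 1, since C contains j, so that s_j^S >= s_j r^(2(S-1)). *)
Lemma cluster_lower_bound (r : R) (C : {set 'I_L}) (j : 'I_L) p :
  0 < r -> (forall k, 0 < m k)%N -> j \in C ->
  1 <= sqrc (a * \prod_(k < L | k \notin C) (w j - w k) ^+ m k)
       * (r ^+ 2) ^+ (cluster_mult m C).+1 ->
  (forall k, sdist 0 (w j) p <= sdist 0 (w k) p) ->
  sdist r (w j) p <= 4 ^+ (\sum_k m k) * r ^+ 4 * smeared_sqr_mod r p.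
Proof.
move=> r0 m0 jC hN jmin.
have r20 : 0 < r ^+ 2 by rewrite exprn_gt0.
set sj := sdist r (w j) p; set N := sqrc _ in hN.
have s_ge0 k : 0 <= sdist r (w k) p by exact: sdist_ge0.
have sj_gt0 : 0 < sj by exact: shifted_sqr_dist_gt0.
have r2sj : r ^+ 2 <= sj by rewrite /sj sdistE lerDr sdist_ge0.
have le_sj k : sj <= sdist r (w k) p by rewrite /sj !(sdistE r) lerD2r.
have le4 k : sqrc (w j - w k) <= 4 * sdist r (w k) p.
  have := jmin k; rewrite (sdistE r) /shifted_sqr_dist /sqrc expr0n !addr0.
  case: (w j) (w k) => [x1 y1] [x2 y2] /=.
  (* the parallelogram law in each coordinate *)
  have := sqr_ge0 (p.1 - x1 + (p.1 - x2)); have := sqr_ge0 (p.2 - y1 + (p.2 - y2)).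
  by lra.
have NE : N <= 4 ^+ (\sum_k m k) * (sqrc a * \prod_(k < L | k \notin C) sdist r (w k) p ^+ m k).
  rewrite /N sqrcM sqrc_prod mulrCA ler_wpM2l ?sqrc_ge0//.
  apply: (@le_trans _ _ (\prod_(k < L | k \notin C) (4 ^+ m k * sdist r (w k) p ^+ m k))).
    apply: ler_prod => k _; rewrite sqrc_ge0 sqrcX -exprMn.
    by rewrite lerXn2r// nnegrE ?sqrc_ge0// mulr_ge0.
  rewrite big_split /= ler_wpM2r//; first by apply: prodr_ge0 => k _; rewrite exprn_ge0.
  rewrite -expr_sum ler_eXn2l ?ltr1n//.
  by rewrite [leqRHS](bigID (fun k => k \notin C)) /= leq_addr.
have PE : sj ^+ cluster_mult m C <= \prod_(k < L | k \in C) sdist r (w k) p ^+ m k.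
  rewrite /cluster_mult expr_sum; apply: ler_prod => k _.
  rewrite exprn_ge0 ?(ltW sj_gt0)//=.
  by rewrite lerXn2r ?nnegrE ?(ltW sj_gt0).
have AE : N * sj ^+ cluster_mult m C <= 4 ^+ (\sum_k m k) * smeared_sqr_mod r p.
  apply: (le_trans (ler_pM _ _ NE PE)); rewrite ?sqrc_ge0 ?exprn_ge0 ?(ltW sj_gt0)//.
  have -> : smeared_sqr_mod r p = sqrc a *
      (\prod_(k < L | k \notin C) sdist r (w k) p ^+ m k
       * \prod_(k < L | k \in C) sdist r (w k) p ^+ m k).
    rewrite /smeared_sqr_mod (bigID (fun k => k \notin C)) /=.
    by congr (_ * (_ * _)); apply: eq_bigl => k; rewrite negbK.
  by rewrite !mulrA.
rewrite [4 ^+ _ * _]mulrC -mulrA.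
apply: (le_trans _ (ler_wpM2l _ AE)); last by rewrite exprn_ge0 ?ltW.
have Sgt0 : (0 < cluster_mult m C)%N.
  by rewrite /cluster_mult (bigD1 j)//= addn_gt0 m0.
case: (cluster_mult m C) Sgt0 hN => // S _ hN.
have hS : (r ^+ 2) ^+ S <= sj ^+ S by rewrite lerXn2r ?nnegrE ?(ltW sj_gt0) ?(ltW r20).
rewrite [leRHS](_ : _ = sj * (N * (r ^+ 2) ^+ 2 * sj ^+ S)); last by by rewrite (exprS sj); ring.
rewrite ler_peMr ?(ltW sj_gt0)//; apply: (le_trans hN).
rewrite [leLHS](_ : _ = N * (r ^+ 2) ^+ 2 * (r ^+ 2) ^+ S); last first.
  by rewrite 2!(exprS (r ^+ 2) (_.+1)) (exprS (r ^+ 2) S); ring.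
by rewrite ler_wpM2l// mulr_ge0 ?sqrc_ge0// exprn_ge0// ltW.
Qed.

End Clusters.

(** * The oscillatory estimate *)

Section Core.
Variable R : realType.
Local Open Scope classical_set_scope.
Local Open Scope complex_scope.
Local Open Scope ring_scope.
Local Notation mu := (@lebesgue_measure R \x @lebesgue_measure R)%E.
Implicit Types (v p : R * R) (u : R * R -> R).

Lemma jet_shifted_sqr_dist v (r : R) (c : R * R) :
  jet v (shifted_sqr_dist r c)
    (fun p => 2 * (p.1 - c.1) * v.1 + 2 * (p.2 - c.2) * v.2)
    (fun=> 2 * v.1 ^+ 2 + 2 * v.2 ^+ 2).
Proof.
have dx p := is_derive_fst v p; have dy p := is_derive_snd v p.
have dc (k : R) p : is_derive p v (fun=> k) 0 by exact: is_derive_cst.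
have dx' p : is_derive p v (fun p => p.1 - c.1) v.1.
  by apply: (is_derive_eq (is_deriveB (dx p) (dc c.1 p))); rewrite subr0.
have dy' p : is_derive p v (fun p => p.2 - c.2) v.2.
  by apply: (is_derive_eq (is_deriveB (dy p) (dc c.2 p))); rewrite subr0.
have c1 : continuous (fun p : R * R => p.1 - c.1).
  by move=> p; apply: cvgB; [exact: cvg_fst|exact: cvg_cst].
have c2 : continuous (fun p : R * R => p.2 - c.2).
  by move=> p; apply: cvgB; [exact: cvg_snd|exact: cvg_cst].
have cc (k : R) : continuous (fun _ : R * R => k) by move=> p; exact: cvg_cst.
split => //.
- exact: continuous_shifted_sqr_dist.
- by apply: continuousD_fun; do 2 (apply: continuousM_fun => //).
- move=> p; rewrite /shifted_sqr_dist.
  under eq_fun do rewrite !(expr2 (_ - _)).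
  apply: (is_derive_eq (is_deriveD (is_deriveD (is_derive_mul (dx' p) (dx' p))
    (is_derive_mul (dy' p) (dy' p))) (dc _ p))).
  by ring.
- move=> p.
  apply: (is_derive_eq (is_deriveD
    (is_derive_mul (is_derive_mul (dc 2 p) (dx' p)) (dc v.1 p))
    (is_derive_mul (is_derive_mul (dc 2 p) (dy' p)) (dc v.2 p)))).
  by ring.
Qed.

Lemma normr_le_sqr (x y : R) : 0 <= y -> x ^+ 2 <= y ^+ 2 -> `|x| <= y.
Proof.
by move=> y0 xy; rewrite -(@ler_pXn2r _ 2)// ?nnegrE// real_normK// num_real.
Qed.

(** The first derivative 2 (x - x_k) is at most 2 s^(1/2), which is at most 2 s K
because s K^2 >= 1. With r' = 0 this also controls the factor |p - c|^2, which may
vanish, by the size s of the smeared factor. *)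
Lemma dominated_shifted_sqr_dist (b : bool) (K : R * R -> R) (r r' : R) c :
  0 <= r' -> r' <= r -> (forall p, 0 <= K p) ->
  (forall p, 1 <= shifted_sqr_dist r c p * K p ^+ 2) ->
  dominated (unit_dir R b) 2 K (shifted_sqr_dist r c) (shifted_sqr_dist r' c).
Proof.
move=> r'0 r'r K0 sK; eexists _, _; split; first exact: jet_shifted_sqr_dist.
move=> p; have := sK p.
have r2 : r' ^+ 2 <= r ^+ 2 by rewrite lerXn2r// nnegrE// (le_trans r'0).
have s0 : 0 <= shifted_sqr_dist r c p by rewrite !addr_ge0 ?sqr_ge0.
have s0' : 0 <= shifted_sqr_dist r' c p by rewrite !addr_ge0 ?sqr_ge0.
have xs : (p.1 - c.1) ^+ 2 <= shifted_sqr_dist r c p.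
  by rewrite /shifted_sqr_dist -addrA lerDl addr_ge0 ?sqr_ge0.
have ys : (p.2 - c.2) ^+ 2 <= shifted_sqr_dist r c p.
  by rewrite /shifted_sqr_dist addrAC lerDr addr_ge0 ?sqr_ge0.
have ss : shifted_sqr_dist r' c p <= shifted_sqr_dist r c p.
  by rewrite /shifted_sqr_dist lerD2l.
move: (shifted_sqr_dist r c p) s0 xs ys ss => s s0 xs ys ss sK1.
have key x : x ^+ 2 <= s -> `|2 * x| <= 2 * s * K p.
  move=> xs'; rewrite normrM normr_nat -mulrA ler_pM2l//.
  apply: normr_le_sqr; first by rewrite mulr_ge0.
  by rewrite exprMn expr2 -mulrA (le_trans xs')// ler_peMr.
split.
- by rewrite ger0_norm.
- by case: b; rewrite /unit_dir /= !(mulr0, mulr1) ?addr0 ?add0r; exact: key.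
- case: b; rewrite /unit_dir /= expr0n expr1n /= mulr0 mulr1 ?addr0 ?add0r
    normr_nat -mulrA -[leLHS]mulr1 [2 ^+ 2](_ : _ = 2 * 2); try ring;
    rewrite -mulrA ler_pM2l//; lra.
Qed.

Lemma dominated_weaken v c (K K' U u : R * R -> R) : 0 <= c ->
  (forall p, 0 <= K p <= K' p) -> dominated v c K U u -> dominated v c K' U u.
Proof.
move=> c0 KK [u1 [u2 [ju bu]]]; exists u1, u2; split => // p.
have [b0 b1 b2] := bu p; have /andP[K0 KK'] := KK p.
have U0 : 0 <= U p by apply: le_trans b0.
split => //; [apply: (le_trans b1)|apply: (le_trans b2)]; apply: ler_wpM2l => //.
- exact: mulr_ge0.
- by rewrite mulr_ge0 ?sqr_ge0.
- by rewrite lerXn2r// nnegrE// (le_trans K0).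
Qed.

Lemma bernoulli_ineq (x : R) n : 0 <= x <= 1 -> 1 - n%:R * x <= (1 - x) ^+ n.
Proof.
move=> /andP[x0 x1]; elim: n => [|n IHn]; first by rewrite mul0r subr0 expr0.
rewrite exprS -natr1; apply: (le_trans _ (ler_wpM2l _ IHn)); last by rewrite subr_ge0.
have : 0 <= n%:R * x * x by rewrite !mulr_ge0.
lra.
Qed.

Local Notation sdist r z := (shifted_sqr_dist r (pair_of_complex z)).

Variables (L : nat) (a : R[i]) (w : 'I_L -> R[i]) (m : 'I_L -> nat).
Local Notation D := (\sum_k m k)%N.
Local Notation A := (smeared_sqr_mod a w m).

Lemma dominated_smeared (b : bool) (K : R * R -> R) (r r' : R) :
  0 <= r' -> r' <= r -> (forall p, 0 <= K p) ->
  (forall p k, 1 <= sdist r (w k) p * K p ^+ 2) ->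
  dominated (unit_dir R b) (D%:R * 2) K (A r) (A r').
Proof.
move=> r'0 r'r K0 sK.
have -> : A r = fun p => `|sqrc a| * \prod_(k < L) sdist r (w k) p ^+ m k.
  by rewrite (ger0_norm (sqrc_ge0 a)).
rewrite -[D%:R * 2]add0r natr_sum mulr_suml.
apply: dominatedM => //; first by apply: sumr_ge0 => k _; rewrite mulr_ge0.
  exact: dominated_cst.
apply: dominated_prod => // k.
by apply: dominatedX => //; apply: dominated_shifted_sqr_dist.
Qed.

Lemma smeared_gt0 r p : 0 < r -> 0 < sqrc a -> 0 < A r p.
Proof.
move=> r0 a0; rewrite mulr_gt0//; apply: prodr_gt0 => k _.
by rewrite exprn_gt0// shifted_sqr_dist_gt0.
Qed.

(** The function phi (2 A - Q) / A^2 to which Green's identity is applied, where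
A = A r and Q = A 0 <= A. *)
Lemma dominated_corrector (b : bool) (K phi : R * R -> R) (r B : R) :
  0 <= r -> (forall p, 0 < A r p) -> (forall p, 1 <= K p) ->
  (forall p k, 1 <= sdist r (w k) p * K p ^+ 2) ->
  dominated (unit_dir R b) 1 (fun=> 1) (fun=> B) phi ->
  dominated (unit_dir R b) (1 + 10 * D%:R) K (fun p => B * (3 * (A r p)^-1))
    (fun p => phi p * ((2 * A r p - A 0 p) * ((A r p)^-1 * (A r p)^-1))).
Proof.
move=> r0 A_gt0 K1 sK dphi.
have K0 p : 0 <= K p by exact: le_trans (K1 p).
pose cA : R := D%:R * 2.
have cA0 : 0 <= cA by rewrite mulr_ge0.
have dA : dominated (unit_dir R b) cA K (A r) (A r) by exact: dominated_smeared.
have dQ : dominated (unit_dir R b) cA K (A r) (A 0) by exact: dominated_smeared.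
have dV := dominatedV A_gt0 cA0 dA.
have d2 : dominated (unit_dir R b) cA K (fun p => 2 * A r p)
    (fun p => 2 * A r p).
  have := dominatedM K0 (lexx 0) cA0 (dominated_cst (unit_dir R b) 2 K) dA.
  by rewrite add0r normr_nat.
have dN : dominated (unit_dir R b) cA K (fun p => A r p) (fun p => - A 0 p).
  have := dominatedM K0 (lexx 0) cA0 (dominated_cst (unit_dir R b) (- 1) K) dQ.
  rewrite add0r normrN1.
  under [X in dominated _ _ _ X]eq_fun do rewrite mul1r.
  by under [X in dominated _ _ _ _ X]eq_fun do rewrite mulN1r.
have -> : 1 + 10 * D%:R = 1 + (cA + (2 * cA + 2 * cA)) by rewrite /cA; ring.
have -> : (fun p => B * (3 * (A r p)^-1)) =
    (fun p => B * ((2 * A r p + A r p) * ((A r p)^-1 * (A r p)^-1))).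
  by apply/funext => p; field; rewrite lt0r_neq0.
apply: dominatedM => //; first by rewrite !addr_ge0 ?mulr_ge0.
  by apply: dominated_weaken dphi => // p; rewrite ler01 K1.
apply: dominatedM => //; rewrite ?addr_ge0 ?mulr_ge0//; first exact: dominatedD.
by apply: dominatedM; rewrite ?mulr_ge0.
Qed.

Lemma smeared_le r p : A 0 p <= A r p.
Proof.
rewrite ler_wpM2l ?sqrc_ge0//; apply: ler_prod => k _.
rewrite exprn_ge0 ?sdist_ge0//= lerXn2r ?nnegrE ?sdist_ge0//.
by rewrite (sdistE r) lerDl sqr_ge0.
Qed.

(** Q / A is the product of the (1 - r^2 / s_k)^(m_k), each of which is at least
(1 - r^2 / s)^(m_k); the rest is Bernoulli's inequality. *)
Lemma smeared_deficit r (s : R) p : 0 < r -> 0 < sqrc a -> r ^+ 2 <= s ->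
  (forall k, s <= sdist r (w k) p) -> 1 - A 0 p / A r p <= D%:R * (r ^+ 2 / s).
Proof.
move=> r0 a0 rs sk.
have s0 : 0 < s by rewrite (lt_le_trans _ rs)// exprn_gt0.
have x01 : 0 <= r ^+ 2 / s <= 1.
  by rewrite divr_ge0 ?sqr_ge0 ?(ltW s0)//= ler_pdivrMr// mul1r.
have A0 := smeared_gt0 p r0 a0.
suff H : (1 - r ^+ 2 / s) ^+ D * A r p <= A 0 p.
  rewrite lerBlDr addrC -lerBlDr; apply: (le_trans (bernoulli_ineq _ x01)).
  by rewrite ler_pdivlMr.
rewrite mulrCA ler_wpM2l ?sqrc_ge0// expr_sum -big_split /=.
apply: ler_prod => k _.
have x0 : 0 <= 1 - r ^+ 2 / s by rewrite subr_ge0; case/andP: x01.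
rewrite -exprMn exprn_ge0 ?mulr_ge0 ?sdist_ge0//=.
rewrite lerXn2r ?nnegrE ?mulr_ge0 ?sdist_ge0//.
rewrite mulrBl mul1r lerBlDr (sdistE r) lerD2l -(sdistE r) -mulrA.
rewrite ler_peMr ?sqr_ge0// mulrC ler_pdivlMr// mul1r; exact: sk.
Qed.

(** Replaces the integrand E phi by H = E (phi - Q G) - c0^-1 E (Laplacian of G),
which differs from it by derivatives of compactly supported functions. With s the
smeared squared distance to the nearest root and K = 1 + s^(-1/2), the terms of H
are of size r^4 / s^2 and K^2 / A; the latter is at most of size
r^4 (1 + 1 / s) / s by the lower bound for A. *)
Lemma oscillatory_estimate (M B r c0 : R) (phi E : R * R -> R)
    (E1 E2 : bool -> R * R -> R) :
  0 < M -> 0 < r -> 0 < sqrc a -> 1 <= c0 -> (0 < L)%N ->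
  (forall k, 0 < m k)%N ->
  (forall p, ~ box M p -> phi p = 0) ->
  (forall b, dominated (unit_dir R b) 1 (fun=> 1) (fun=> B) phi) ->
  (forall b, jet (unit_dir R b) E (E1 b) (E2 b)) ->
  (forall p, `|E p| <= 1) ->
  (forall p, E2 false p + E2 true p = - (c0 * A 0 p * E p)) ->
  (forall j p, (forall k, sdist 0 (w j) p <= sdist 0 (w k) p) ->
    sdist r (w j) p <= 4 ^+ D * r ^+ 4 * A r p) ->
  `|Rintegral mu setT (fun p => E p * phi p)| <=
    (B + B * (D%:R ^+ 2 + 18 * (1 + 10 * D%:R) ^+ 2 * 4 ^+ D))
     * (fine (mu (box M)) + D%:R * pi ^+ 2) * r ^+ 2.
Proof.
move=> M0 r0 a0 c01 L0 m0 phi0 dphi jE E_le1 lapE lowA.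
set C1 := B * (_ + _); set V := fine _.
have V0 : 0 <= V by rewrite fine_ge0.
have B0 : 0 <= B.
  by have [u1 [u2 [_ /(_ (0, 0)) [b _ _]]]] := dphi false; apply: le_trans b.
have C10 : 0 <= C1.
  by rewrite mulr_ge0// addr_ge0 ?sqr_ge0// !mulr_ge0 ?sqr_ge0// exprn_ge0.
have LD : (L <= D)%N.
  rewrite -[leqLHS]card_ord -sum1_card; apply: leq_sum => k _; exact: m0.
have r20 : 0 < r ^+ 2 by rewrite exprn_gt0.
have pi20 : 0 <= (pi : R) ^+ 2 by rewrite sqr_ge0.
have LDR : L%:R * (pi : R) ^+ 2 <= D%:R * pi ^+ 2 by rewrite ler_wpM2r// ler_nat.
have cphi : continuous phi by have [u1 [u2 [[]]]] := dphi false.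
have cE : continuous E by have [] := jE false.
have cEphi : continuous (fun p => E p * phi p) by exact: continuousM_fun.
have Ephi0 p : ~ box M p -> E p * phi p = 0 by move=> Mp; rewrite phi0// mulr0.
have phiB p : `|phi p| <= B.
  by have [u1 [u2 [_ /(_ p) [b _ _]]]] := dphi false.
have sV2_ge0 p : 0 <= \sum_(k < L) sdist r (w k) p ^- 2.
  by apply: sumr_ge0 => k _; rewrite invr_ge0 sqr_ge0.
(* for r >= 1 the bound |E phi| <= B is enough *)
have [r1|r1] := leP 1 r.
  have r21 : 1 <= r ^+ 2 by rewrite exprn_ege1.
  have := @Rintegral_plane_le _ M B r L (fun k => pair_of_complex (w k)) _ cEphi
    Ephi0 M0 r0 B0.
  move=> /(_ _) H; apply: (le_trans (H _)) => [p Mp|].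
    rewrite normrM (le_trans (ler_pM _ _ (E_le1 p) (phiB p)))// mul1r ler_peMr//.
    by rewrite lerDl.
  rewrite -mulrA ler_pM ?lerDl ?addr_ge0//; first by rewrite mulr_ge0// sqr_ge0.
  rewrite [leRHS]mulrDl; apply: lerD; first exact: ler_peMr.
  rewrite expr_div_n mulrA.
  apply: (@le_trans _ _ (D%:R * pi ^+ 2 * 1)); last by rewrite ler_wpM2l// mulr_ge0.
  apply: ler_pM => //; first by rewrite mulr_ge0.
    by rewrite invr_ge0 ltW.
  by rewrite invf_le1.
pose j p := [arg min_(i < Ordinal L0) sdist 0 (w i) p]%O.
have jmin p k : sdist 0 (w (j p)) p <= sdist 0 (w k) p.
  by rewrite /j; case: arg_minP => // i _ /(_ k); exact.
pose s p := sdist r (w (j p)) p.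
have s_gt0 p : 0 < s p by exact: shifted_sqr_dist_gt0.
have r2s p : r ^+ 2 <= s p by rewrite /s (sdistE r) lerDr sdist_ge0.
have s_min p k : s p <= sdist r (w k) p by rewrite /s !(sdistE r) lerD2r.
have As p : s p <= 4 ^+ D * r ^+ 4 * A r p by apply: lowA.
pose q p := (Num.sqrt (s p))^-1.
have q0 p : 0 <= q p by rewrite invr_ge0 sqrtr_ge0.
have q2 p : q p ^+ 2 = (s p)^-1 by rewrite exprVn sqr_sqrtr ?(ltW (s_gt0 p)).
pose K p := 1 + q p.
have K0 p : 1 <= K p by rewrite lerDl.
have K0' p : 0 <= K p by exact: le_trans (K0 p).
have qK p : q p ^+ 2 <= K p ^+ 2.
  by rewrite lerXn2r ?nnegrE// lerDr.
have sK p k : 1 <= sdist r (w k) p * K p ^+ 2.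
  apply: (@le_trans _ _ (s p * q p ^+ 2)); first by rewrite q2 divff ?lt0r_neq0.
  by rewrite ler_pM ?sqr_ge0 ?(ltW (s_gt0 p)).
have A_gt0 p : 0 < A r p by exact: smeared_gt0.
have A_neq0 p : A r p != 0 by rewrite lt0r_neq0.
pose G p := phi p * ((2 * A r p - A 0 p) * ((A r p)^-1 * (A r p)^-1)).
have dG b := dominated_corrector (ltW r0) A_gt0 K0 sK (dphi b).
have G0 p : ~ box M p -> G p = 0 by move=> Mp; rewrite /G phi0// mul0r.
have [Gx1 [Gx2 [jGx bGx]]] := dG false.
have [Gy1 [Gy2 [jGy bGy]]] := dG true.
have [cWx Wx0 iWx] := green (jE false) jGx G0.
have [cWy Wy0 iWy] := green (jE true) jGy G0.
have c0p : 0 < c0 by rewrite (lt_le_trans ltr01).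
pose H p := E p * phi p - c0^-1 * ((E p * Gx2 p - E2 false p * G p)
                                   + (E p * Gy2 p - E2 true p * G p)).
(* the identity phi - Q G = phi (1 - Q / A)^2 *)
have HE p : H p = E p * (phi p * (1 - A 0 p / A r p) ^+ 2)
    - c0^-1 * (E p * (Gx2 p + Gy2 p)).
  have -> : H p = E p * phi p - c0^-1 * (E p * (Gx2 p + Gy2 p))
      + c0^-1 * ((E2 false p + E2 true p) * G p) by rewrite /H; ring.
  rewrite lapE /G; field.
  by rewrite A_neq0 lt0r_neq0.
have cW : continuous (fun p => (E p * Gx2 p - E2 false p * G p)
                                   + (E p * Gy2 p - E2 true p * G p)).
  exact: continuousD_fun.
have cc : continuous (fun _ : R * R => c0^-1) by move=> p; exact: cvg_cst.
have ccW := continuousM_fun cc cW.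
have cH : continuous H by move=> p; apply: cvgB; [exact: cEphi|exact: ccW].
have W0 p : ~ box M p -> (E p * Gx2 p - E2 false p * G p)
                                   + (E p * Gy2 p - E2 true p * G p) = 0.
  by move=> Mp; rewrite Wx0// Wy0// addr0.
have H0 p : ~ box M p -> H p = 0.
  by move=> Mp; rewrite /H W0// Ephi0// mulr0 subr0.
have intH : Rintegral mu setT (fun p => E p * phi p) = Rintegral mu setT H.
  have iW := supported_integrable cW W0.
  rewrite /H RintegralB//; last 2 first.
  - exact: supported_integrable cEphi Ephi0.
  - by apply: (@supported_integrable _ M _ ccW) => p Mp; rewrite W0// mulr0.
  rewrite RintegralZl// RintegralD//; last 2 first.
  - exact: supported_integrable cWx Wx0.
  - exact: supported_integrable cWy Wy0.
  by rewrite iWx iWy addr0 mulr0 subr0.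
rewrite intH.
have bH p : `|H p| <= C1 * r ^+ 4 * (1 + \sum_(k < L) sdist r (w k) p ^- 2).
  have sum_s : s p ^- 2 <= \sum_(k < L) sdist r (w k) p ^- 2.
    rewrite (bigD1 (j p))//= lerDl; apply: sumr_ge0 => k _.
    by rewrite invr_ge0 sqr_ge0.
  apply: (@le_trans _ _ (C1 * r ^+ 4 * (1 + s p ^- 2))); last first.
    by rewrite ler_wpM2l ?lerD2l// mulr_ge0// exprn_ge0// ltW.
  have bG (g : R) : `|g| <= (1 + 10 * D%:R) ^+ 2 * (B * (3 * (A r p)^-1))
      * K p ^+ 2 ->
      `|g| <= 9 * (1 + 10 * D%:R) ^+ 2 * 4 ^+ D * B * (r ^+ 4 * (1 + s p ^- 2)).
    move=> /le_trans; apply.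
    have AV : (A r p)^-1 <= 4 ^+ D * r ^+ 4 * (s p)^-1.
      rewrite -[leLHS]mul1r ler_pdivrMr// mulrAC ler_pdivlMr// mul1r.
      exact: As.
    have K2 : K p ^+ 2 <= 2 + 2 * (s p)^-1.
      rewrite -q2 /K; have := sqr_ge0 (1 - q p); lra.
    have s2 : (s p)^-1 * (2 + 2 * (s p)^-1) <= 3 * (1 + s p ^- 2).
      by rewrite -exprVn; have := sqr_ge0 (1 - (s p)^-1); lra.
    have AK : (A r p)^-1 * K p ^+ 2 <= 4 ^+ D * r ^+ 4 * (3 * (1 + s p ^- 2)).
      apply: (le_trans (ler_pM _ _ AV K2)); rewrite ?invr_ge0 ?sqr_ge0 ?(ltW (A_gt0 p))//.
      rewrite -[leLHS]mulrA ler_wpM2l// mulr_ge0 ?exprn_ge0// ltW//.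
    have -> : (1 + 10 * D%:R) ^+ 2 * (B * (3 * (A r p)^-1)) * K p ^+ 2 =
      (1 + 10 * D%:R) ^+ 2 * B * 3 * ((A r p)^-1 * K p ^+ 2) by ring.
    apply: (le_trans (ler_wpM2l _ AK)); first by rewrite !mulr_ge0 ?sqr_ge0.
    by rewrite le_eqVlt; apply/orP; left; apply/eqP; ring.
  have [_ _ /bG bx] := bGx p; have [_ _ /bG by_] := bGy p.
  rewrite HE; apply: (le_trans (ler_normB _ _)).
  have -> : C1 * r ^+ 4 * (1 + s p ^- 2) = B * D%:R ^+ 2 * (r ^+ 4 * (1 + s p ^- 2))
    + 2 * (9 * (1 + 10 * D%:R) ^+ 2 * 4 ^+ D * B * (r ^+ 4 * (1 + s p ^- 2))).
    by rewrite /C1; ring.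
  apply: lerD.
  - rewrite normrM -[leRHS]mul1r ler_pM// normrM -mulrA ler_pM//.
    rewrite ger0_norm ?sqr_ge0//.
    have d0 : 0 <= 1 - A 0 p / A r p.
      by rewrite subr_ge0 ler_pdivrMr// mul1r smeared_le.
    have d1 := smeared_deficit r0 a0 (r2s p) (s_min p).
    apply: (@le_trans _ _ ((D%:R * (r ^+ 2 / s p)) ^+ 2)).
      by rewrite lerXn2r ?nnegrE// (le_trans d0).
    have -> : (D%:R * (r ^+ 2 / s p)) ^+ 2 = D%:R ^+ 2 * (r ^+ 4 * s p ^- 2).
      by field; rewrite lt0r_neq0.
    by rewrite ler_wpM2l ?sqr_ge0// ler_wpM2l ?lerDr// exprn_ge0// ltW.
  - rewrite normrM -[leRHS]mul1r ler_pM//.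
      by rewrite ger0_norm ?invr_ge0 ?(ltW c0p)// invf_le1.
    rewrite normrM -[leRHS]mul1r ler_pM// mulrDl mul1r.
    by rewrite (le_trans (ler_normD _ _))// lerD.
apply: (le_trans (@Rintegral_plane_le _ M (C1 * r ^+ 4) r L
  (fun k => pair_of_complex (w k)) H cH H0 M0 r0 _ _)).
- by rewrite mulr_ge0// exprn_ge0// ltW.
- by move=> p _; exact: bH.
(* the kernels contribute r^4 (pi / r)^2, and r^4 <= r^2 on the rest *)
have r4 : r ^+ 4 * (V + L%:R * (pi / r) ^+ 2) <= (V + D%:R * pi ^+ 2) * r ^+ 2.
  have -> : r ^+ 4 * (V + L%:R * (pi / r) ^+ 2) =
    (r ^+ 2 * V + L%:R * pi ^+ 2) * r ^+ 2 by field; rewrite lt0r_neq0.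
  rewrite ler_wpM2r ?(ltW r20)// lerD// ler_piMl// expr_le1 ?(ltW r0)//.
  exact: ltW.
rewrite -mulrA; apply: (le_trans (ler_wpM2l C10 r4)).
rewrite mulrA ler_wpM2r ?(ltW r20)// ler_wpM2r ?lerDr//.
by rewrite addr_ge0// mulr_ge0.
Qed.

End Core.

(** * From the complex integral to real waves *)

Section Final.
Variable R : realType.
Local Open Scope classical_set_scope.
Local Open Scope complex_scope.
Local Open Scope ring_scope.
Local Notation mu := (@lebesgue_measure R \x @lebesgue_measure R)%E.
Local Notation Re := (@complex.Re R).
Local Notation Im := (@complex.Im R).
Implicit Types (v p : R * R) (u : R * R -> R).

Lemma smooth2_dominated (M : R) u : smooth2 u ->
  (forall p, ~ box M p -> u p = 0) ->
  exists B, forall B', B <= B' ->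
    forall b, dominated (unit_dir R b) 1 (fun=> 1) (fun=> B') u.
Proof.
move=> su u0.
have jb b : jet (unit_dir R b) u (partial b u) (partial b (partial b u)).
  have [c0 d0] := su [::]; have [c1 d1] := su [:: b]; have [c2 _] := su [:: b; b].
  by split.
have bb b : exists2 B, 0 <= B & forall p, [/\ `|u p| <= B, `|partial b u p| <= B
    & `|partial b (partial b u) p| <= B].
  have [c0 c1 c2 d0 d1] := jb b.
  have u10 p : ~ box M p -> partial b u p = 0 by exact: is_derive_off_box (d0 p).
  have u20 p : ~ box M p -> partial b (partial b u) p = 0.
    exact: is_derive_off_box (d1 p).
  have [B0 B0p H0] := supported_bounded c0 u0.
  have [B1 B1p H1] := supported_bounded c1 u10.
  have [B2 B2p H2] := supported_bounded c2 u20.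
  exists (B0 + B1 + B2) => [|p]; first by rewrite !addr_ge0.
  by split; [apply: (le_trans (H0 p))|apply: (le_trans (H1 p))|
    apply: (le_trans (H2 p))]; lra.
have [Bx Bx0 Hx] := bb false; have [By By0 Hy] := bb true.
exists (Bx + By) => B' BB' b; exists (partial b u), (partial b (partial b u)).
split => // p; rewrite expr1n !mul1r !mulr1.
by case: b; [have [h0 h1 h2] := Hy p|have [h0 h1 h2] := Hx p]; split; lra.
Qed.

Lemma Cc_infty_box (phi : R[i] -> R[i]) : Cc_infty phi ->
  exists2 M, 0 < M & forall p, ~ box M p -> phi (complex_of_pair p) = 0.
Proof.
move=> [_ _ /compact_bounded [N [Nr HN]]].
pose M := `|N| + 1.
have NM : N < M by rewrite (le_lt_trans (ler_norm N))// ltrDl.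
have M0 : 0 < M by rewrite ltr_wpDl.
exists M => // p Mp; apply/eqP/negPn/negP => phip; apply: Mp.
have := HN _ NM p (@subset_closure _ [set p | phi (complex_of_pair p) != 0] p phip).
rewrite /= prod_normE ge_max !ler_norml => /andP[h1 h2].
by split; rewrite /= in_itv.
Qed.

Lemma cabs_le (z : R[i]) : cabs z <= `|Re z| + `|Im z|.
Proof.
rewrite cabsE -[leRHS]ger0_norm ?addr_ge0// -sqrtr_sqr ler_wsqrtr//.
rewrite /sqrc sqrrD !real_normK ?num_real// -addrA [X in _ <= _ + X]addrC.
by rewrite lerD2l lerDl mulrn_wge0// mulr_ge0.
Qed.

(** The real and imaginary parts of e(f) phi are sums of two products of a wave
and a real-valued smooth function. *)
Lemma osc_integral_le (phi : R[i] -> R[i]) (f : {poly R[i]}) (M N : R) :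
  smooth2 (fun p => Re (phi (complex_of_pair p))) ->
  smooth2 (fun p => Im (phi (complex_of_pair p))) ->
  (forall p, ~ box M p -> phi (complex_of_pair p) = 0) ->
  (forall (g E : R * R -> R), is_wave f E ->
    g = (fun p => Re (phi (complex_of_pair p))) \/
    g = (fun p => Im (phi (complex_of_pair p))) ->
    `|Rintegral mu setT (fun p => E p * g p)| <= N) ->
  cabs (osc_integral phi f) <= 4 * N.
Proof.
move=> sR sI phi0 HN.
set g1 := (fun p => Re (phi (complex_of_pair p))) in sR HN.
set g2 := (fun p => Im (phi (complex_of_pair p))) in sI HN.
have [cg1 _] := sR [::]; have [cg2 _] := sI [::].
have g10 p : ~ box M p -> g1 p = 0 by move=> Mp; rewrite /g1 phi0.
have g20 p : ~ box M p -> g2 p = 0 by move=> Mp; rewrite /g2 phi0.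
have wc := is_wave_cos f; have ws := is_wave_sin f.
have cont E : is_wave f E -> continuous E by case=> E1 [E2 [/(_ true) []]].
have int E g : is_wave f E -> continuous g -> (forall p, ~ box M p -> g p = 0) ->
    mu.-integrable setT (EFin \o (fun p => E p * g p)).
  move=> wE cg g0; apply: (@supported_integrable _ M).
    by apply: continuousM_fun => //; exact: cont.
  by move=> p Mp; rewrite g0// mulr0.
apply: (le_trans (cabs_le _)); rewrite /osc_integral /complex_integral /=.
have -> : (fun p => Re (echar f.[complex_of_pair p] * phi (complex_of_pair p)))
    = (fun p => cos (phase f p) * g1 p - sin (phase f p) * g2 p).
  by apply/funext => p; rewrite Re_mul echar_horner.
have -> : (fun p => Im (echar f.[complex_of_pair p] * phi (complex_of_pair p)))
    = (fun p => cos (phase f p) * g2 p + sin (phase f p) * g1 p).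
  by apply/funext => p; rewrite Im_mul echar_horner.
rewrite RintegralB//; last 2 first.
- exact: (int (fun p => cos (phase f p))).
- exact: (int (fun p => sin (phase f p))).
rewrite RintegralD//; last 2 first.
- exact: (int (fun p => cos (phase f p))).
- exact: (int (fun p => sin (phase f p))).
have h1 := HN g1 _ wc (or_introl erefl); have h2 := HN g2 _ wc (or_intror erefl).
have h3 := HN g1 _ ws (or_introl erefl); have h4 := HN g2 _ ws (or_intror erefl).
apply: (le_trans (lerD (ler_normB _ _) (ler_normD _ _))).
by apply: (le_trans (lerD (lerD h1 h4) (lerD h2 h3))); lra.
Qed.

End Final.

Theorem proposition1p3 (R : realType) (d : nat) (hd : (2 <= d)%N)
    (phi : R[i] -> R[i]) (hphi : Cc_infty phi) :
  exists C : R, forall f : {poly R[i]}, size f = d.+1 ->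
    forall (L : nat) (a : R[i]) (w : 'I_L -> R[i]) (m : 'I_L -> nat),
      injective w ->
      (forall j, (0 < m j)%N) ->
      deriv f = a *: \prod_(j < L) ('X - (w j)%:P) ^+ m j ->
      cabs (osc_integral phi f) <= C * max_min_cluster_term a w m.
Proof.
have [M M0 phi0] := Cc_infty_box hphi.
have [sR sI _] := hphi.
have R0 p : ~ box M p -> complex.Re (phi (complex_of_pair p)) = 0.
  by move=> /phi0 ->.
have I0 p : ~ box M p -> complex.Im (phi (complex_of_pair p)) = 0.
  by move=> /phi0 ->.
have [B1 dR] := smooth2_dominated sR R0.
have [B2 dI] := smooth2_dominated sI I0.
pose B := Num.max B1 B2.
(* the constant of [oscillatory_estimate], with D = d - 1 *)
pose N : R := (B + B * (d.-1%:R ^+ 2 + 18 * (1 + 10 * d.-1%:R) ^+ 2 * 4 ^+ d.-1))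
  * (fine ((@lebesgue_measure R \x @lebesgue_measure R)%E (box M))
     + d.-1%:R * pi ^+ 2).
exists (4 * N) => f sf L a w m winj m0 df.
have [a0 DE] := deriv_factorization_degree hd sf df.
have sa0 : 0 < sqrc a by rewrite sqrc_gt0.
have L0 : (0 < L)%N.
  by case: L w m winj m0 df DE => // w m _ _ _; rewrite big_ord0 => E; rewrite -E in hd.
have T0 := max_min_cluster_gt0 m a0 winj L0.
set T := max_min_cluster_term a w m in T0 *.
(* the scale r has r^2 = max_j min_C of the cluster terms *)
pose r := Num.sqrt T.
have r0 : 0 < r by rewrite sqrtr_gt0.
have r2 : r ^+ 2 = T by rewrite sqr_sqrtr// ltW.
have c01 : 1 <= 8 * pi ^+ 2 :> R.
  by have := pi_ge2 R; nra.
rewrite -r2 -mulrA; apply: (osc_integral_le sR sI phi0).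
move=> g E [E1 [E2 [jE E_le1 lapE]]] gE.
have dg b : dominated (unit_dir R b) 1 (fun=> 1) (fun=> B) g.
  by case: gE => ->; [apply: dR|apply: dI]; rewrite /B le_max lexx ?orbT.
have g0 p : ~ box M p -> g p = 0 by case: gE => ->; [exact: R0|exact: I0].
rewrite /N -DE /=.
apply: (@oscillatory_estimate _ _ a w m M B r (8 * pi ^+ 2) g E E1 E2) => //.
- move=> p; rewrite lapE; congr (- (_ * _ * _)).
  rewrite df hornerZ horner_prod sqrcM sqrc_prod; congr (_ * _).
  apply: eq_bigr => k _.
  by rewrite horner_exp sqrcX !hornerE sdist0E.
- move=> j p jmin; have [C jC hC] := max_min_cluster_witness m a0 winj j.
  by apply: (cluster_lower_bound r0 m0 jC _ jmin); rewrite r2.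
Qed.
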